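(* Let $P_1,\dots,P_m$ be smooth compact manifolds, let $F$ be a good functor from $\mathcal{O}(\coprod_iP_i)$ to $\mathrm{Spaces}$, with a chosen basepoint in $F(\coprod_iP_i)$, regarded also as a functor on $\mathcal{O}(\vec{P})=\prod_i\mathcal{O}(P_i)$, and let $k$ be a non-negative integer. Then there is an equivalence $$T_kF\stackrel{\simeq}{\longrightarrow}\underset{|\vec{j}|\leq k}{\mathrm{holim}}\ T_{\vec{j}}F,$$ where the homotopy limit is over the poset of $m$-tuples $\vec{j}$ of non-negative integers with $|\vec{j}|\le k$.
   Context: $\mathrm{Spaces}$ is the category of fibrant simplicial sets; an equivalence of functors is an objectwise weak homotopy equivalence. $\mathcal{O}(X)$ is the poset of open subsets of a manifold $X$. The categories $\mathcal{O}(\coprod_iP_i)$ and $\mathcal{O}(\vec{P})=\prod_i\mathcal{O}(P_i)$ are identified via $U\mapsto\vec{U}=(U\cap P_1,\dots,U\cap P_m)$. An inclusion $i:U\subset V$ is an isotopy equivalence if there is an embedding $e:V\to U$ with $i\circ e$, $e\circ i$ isotopic to the identities. A contravariant functor $F$ is good if it takes isotopy equivalences to homotopy equivalences and $F(\cup_iU_i)\to\mathrm{holim}_iF(U_i)$ is a weak equivalence for every nested (increasing) sequence $\{U_i\}$. $\mathcal{O}_k(U)\subset\mathcal{O}(U)$ is the full subposet of open sets diffeomorphic to at most $k$ disjoint open balls, and $\mathcal{O}_{\vec{j}}(\vec{U})=\prod_i\mathcal{O}_{j_i}(U_i)$. Single variable approximation: $T_kF(U)=\mathrm{holim}_{\mathcal{O}_k(U)}F$.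 Multivariable approximation: $T_{\vec{j}}F(\vec{U})=\mathrm{holim}_{\mathcal{O}_{\vec{j}}(\vec{U})}F$. For $\vec{j}=(j_1,\dots,j_m)$, $|\vec{j}|=\sum_ij_i$; tuples are ordered entrywise, and for $\vec{k}\leq\vec{j}$ there is a canonical restriction map $T_{\vec{j}}F\to T_{\vec{k}}F$, making $\vec{j}\mapsto T_{\vec{j}}F$ a contravariant functor of $\vec{j}$. The map in the claim is the canonical one, induced by the inclusions $\mathcal{O}_{\vec{j}}(\vec{U})\subset\mathcal{O}_k(U)$ for $|\vec{j}|\le k$. *)

(* Defs.v *)
From HB Require Import structures.
From mathcomp Require Import all_boot all_order all_algebra.
From mathcomp Require Import all_classical all_reals all_analysis.

Set Implicit Arguments.
Unset Strict Implicit.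
Unset Printing Implicit Defensive.

Import Order.TTheory GRing.Theory Num.Theory.
Import numFieldNormedType.Exports.

Local Open Scope classical_set_scope.
Local Open Scope ring_scope.

Local Obligation Tactic := idtac.

(* The morphisms [m] -> [n] of the simplex category, [n] being 'I_n.+1. *)
Record dmap (m n : nat) := DMap {
  dfun :> 'I_m.+1 -> 'I_n.+1;
  dmono : forall i j : 'I_m.+1, (i <= j)%N -> (dfun i <= dfun j)%N }.

Lemma dmapP m n (f g : dmap m n) : (forall i, f i = g i) -> f = g.
Proof.
case: f g => [f hf] [g hg] /= fg.
have e : f = g by apply/funext.
by subst g; congr DMap; exact: Prop_irrelevance.
Qed.

Definition did n : dmap n n := @DMap n n id (fun _ _ h => h).

Definition dcomp l m n (g : dmap m n) (f : dmap l m) : dmap l n :=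
  @DMap l n (fun i => g (f i)) (fun _ _ h => dmono g (dmono f h)).

Definition dconst m n (i : 'I_n.+1) : dmap m n :=
  @DMap m n (fun=> i) (fun _ _ _ => leqnn _).

Definition dsurj m n (a : dmap m n) := forall i, exists j, a j = i.

Record sSet := SSet {
  simp :> nat -> Type;
  sact : forall m n, dmap m n -> simp n -> simp m;
  sact_id : forall n (x : simp n), sact (did n) x = x;
  sact_comp : forall l m n (g : dmap m n) (f : dmap l m) (x : simp n),
    sact (dcomp g f) x = sact f (sact g x) }.

Record smap (X Y : sSet) := SMap {
  sfun :> forall n, X n -> Y n;
  snat : forall m n (a : dmap m n) (x : X n),
    sfun (sact a x) = sact a (sfun x) }.

Lemma smapP (X Y : sSet) (f g : smap X Y) :
  (forall n (x : X n), f n x = g n x) -> f = g.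
Proof.
case: f g => [f hf] [g hg] /= fg.
have e : f = g by apply: functional_extensionality_dep => n; apply/funext.
by subst g; congr SMap; exact: Prop_irrelevance.
Qed.

Definition sidmap (X : sSet) : smap X X := @SMap X X (fun _ x => x) (fun _ _ _ _ => erefl).

Program Definition scompose (X Y Z : sSet) (g : smap Y Z) (f : smap X Y) :
  smap X Z := @SMap X Z (fun n x => g n (f n x)) _.
Next Obligation. by move=> X Y Z g f m n a x /=; rewrite (snat f) (snat g). Qed.

Program Definition Delta (n : nat) : sSet :=
  @SSet (fun m => dmap m n) (fun _ _ a s => dcomp s a) _ _.
Next Obligation. by move=> *; exact: dmapP. Qed.
Next Obligation. by move=> *; exact: dmapP. Qed.

Program Definition sprod (X Y : sSet) : sSet :=
  @SSet (fun n => (X n * Y n)%type)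
        (fun _ _ a z => (sact a z.1, sact a z.2)) _ _.
Next Obligation. by move=> X Y n [x y] /=; rewrite !sact_id. Qed.
Next Obligation. by move=> X Y *; rewrite /= !sact_comp. Qed.

Definition in_horn n (k : 'I_n.+1) m (s : dmap m n) :=
  exists2 i, i <> k & forall j, s j <> i.

Lemma in_horn_act n (k : 'I_n.+1) l m (a : dmap l m) (s : dmap m n) :
  in_horn k s -> in_horn k (dcomp s a).
Proof. by move=> [i ik h]; exists i => // j; exact: h. Qed.

Program Definition horn n (k : 'I_n.+1) : sSet :=
  @SSet (fun m => {s : dmap m n | in_horn k s})
        (fun l m a s => exist _ (dcomp (sval s) a) (in_horn_act a (svalP s)))
        _ _.
Next Obligation.
by move=> n k m [s hs]; apply: eq_sig_hprop => [*|]; [exact: Prop_irrelevance|exact: dmapP].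
Qed.
Next Obligation.
by move=> *; apply: eq_sig_hprop => [*|]; [exact: Prop_irrelevance|exact: dmapP].
Qed.

Definition kan (X : sSet) :=
  forall n (k : 'I_n.+2) (h : smap (horn k) X),
  exists g : smap (Delta n.+1) X,
    forall m (s : horn k m), g m (sval s) = h m s.

Definition shomotopic (X Y : sSet) (f g : smap X Y) :=
  exists h : smap (sprod X (Delta 1)) Y, forall n (x : X n),
    h n (x, dconst n ord0) = f n x /\ h n (x, dconst n ord_max) = g n x.

Definition homotopy_equiv (X Y : sSet) (f : smap X Y) :=
  exists g : smap Y X, shomotopic (scompose g f) (sidmap X) /\
                       shomotopic (scompose f g) (sidmap Y).

Definition path_related (X : sSet) (x y : X 0%N) :=
  exists e : X 1%N, sact (dconst 0 ord0) e = x /\ sact (dconst 0 ord_max) e = y.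

Definition cst (X : sSet) (x : X 0%N) n : X n := sact (dconst n ord0) x.

(* [a], seen as a map Delta^n -> X, sends the boundary to [x]: by definition
   it represents an element of pi_n (X, x). *)
Definition spherical (X : sSet) (x : X 0%N) n (a : X n) :=
  forall m (s : dmap m n), ~ dsurj s -> sact s a = cst x m.

Definition rel_homotopic (X : sSet) (x : X 0%N) n (a b : X n) :=
  exists h : smap (sprod (Delta n) (Delta 1)) X,
    (forall m (s : dmap m n), h m (s, dconst m ord0) = sact s a /\
                              h m (s, dconst m ord_max) = sact s b) /\
    (forall m (s : dmap m n) (t : dmap m 1), ~ dsurj s -> h m (s, t) = cst x m).

(* [f] induces bijections on pi_0 and, for every base point, on pi_n, n >= 1.
   This is the usual notion when X and Y are fibrant, in which case the two
   relations above are equivalence relations. It is only used for values of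
   space-valued functors and for their homotopy limits, which are fibrant. *)
Definition weak_equiv (X Y : sSet) (f : smap X Y) :=
  [/\ forall x x' : X 0%N, path_related (f _ x) (f _ x') -> path_related x x',
      forall y : Y 0%N, exists x : X 0%N, path_related (f _ x) y,
      forall n (x : X 0%N) (a b : X n.+1), spherical x a -> spherical x b ->
        rel_homotopic (f _ x) (f _ a) (f _ b) -> rel_homotopic x a b
    & forall n (x : X 0%N) (b : Y n.+1), spherical (f _ x) b ->
        exists2 a : X n.+1, spherical x a & rel_homotopic (f _ x) (f _ a) b].

Record presheaf d (C : porderType d) := Presheaf {
  fob :> C -> sSet;
  fres : forall U V : C, (U <= V)%O -> smap (fob V) (fob U);
  fres_id : forall (U : C) (h : (U <= U)%O) n (x : fob U n), fres h n x = x;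
  fres_comp : forall (U V W : C) (h : (U <= V)%O) (h' : (V <= W)%O)
    (h'' : (U <= W)%O) n (x : fob W n),
    fres h n (fres h' n x) = fres h'' n x }.

Record nattrans d (C : porderType d) (F G : presheaf C) := NatTrans {
  ncomp :> forall c, smap (F c) (G c);
  nnat : forall (U V : C) (h : (U <= V)%O) n (x : F V n),
    ncomp U n (fres F h n x) = fres G h n (ncomp V n x) }.

Definition space_valued d (C : porderType d) (F : presheaf C) :=
  forall c, kan (F c).

Definition objectwise_equiv d (C : porderType d) (F G : presheaf C)
  (t : nattrans F G) := forall c, weak_equiv (t c).

(* Bousfield-Kan homotopy limit of the restriction of the contravariant functor
   F to the full subposet S of C: it is the simplicial set of natural maps from
   c |-> N (S^op / c) to F, its n-simplices being the natural families of maps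
   N (S^op / c) x Delta^n -> F c, for c in S. *)
Section Holim.
Context {d : Order.disp_t} {C : porderType d}.
Implicit Types (S : set C) (F G : presheaf C).

(* The p-simplices x_0 >= ... >= x_p >= c of N (S^op / c). *)
Record chain S (c : C) (p : nat) := Chain {
  cpt :> 'I_p.+1 -> C;
  cpt_in : forall i, S (cpt i);
  cpt_ge : forall i, (c <= cpt i)%O;
  cpt_anti : forall i j : 'I_p.+1, (i <= j)%N -> (cpt j <= cpt i)%O }.

Lemma chainP S c p (x y : chain S c p) : (forall i, x i = y i) -> x = y.
Proof.
case: x y => [x x1 x2 x3] [y y1 y2 y3] /= xy.
have e : x = y by apply/funext.
by subst y; congr Chain; exact: Prop_irrelevance.
Qed.

Definition chain_act S c m n (a : dmap m n) (x : chain S c n) : chain S c m :=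
  @Chain S c m (fun i => x (a i)) (fun i => cpt_in x (a i))
    (fun i => cpt_ge x (a i)) (fun i j h => cpt_anti x (dmono a h)).

Program Definition nerve_over S (c : C) : sSet :=
  @SSet (chain S c) (@chain_act S c) _ _.
Next Obligation. by move=> *; exact: chainP. Qed.
Next Obligation. by move=> *; exact: chainP. Qed.

Definition chain_map S S' (c c' : C) (sS : S `<=` S') (h : (c' <= c)%O) p
    (x : chain S c p) : chain S' c' p :=
  @Chain S' c' p x (fun i => sS _ (cpt_in x i))
    (fun i => le_trans h (cpt_ge x i)) (fun i j => @cpt_anti _ _ _ x i j).

Record holim_simp S F (n : nat) := HolimSimp {
  hval :> forall c, S c -> smap (sprod (nerve_over S c) (Delta n)) (F c);
  hnat : forall (c c' : C) (Sc : S c) (Sc' : S c') (h : (c' <= c)%O) p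
    (x : chain S c p) (s : dmap p n),
    hval Sc' p (chain_map (@subset_refl _ S) h x, s) =
    fres F h p (hval Sc p (x, s)) }.

Lemma holim_simpP S F n (u v : holim_simp S F n) :
  (forall c (Sc : S c) p (x : chain S c p) (s : dmap p n),
     u c Sc p (x, s) = v c Sc p (x, s)) -> u = v.
Proof.
case: u v => [u hu] [v hv] /= uv.
have e : u = v.
  apply: functional_extensionality_dep => c; apply/funext => Sc.
  by apply: smapP => p [x s]; exact: uv.
by subst v; congr HolimSimp; exact: Prop_irrelevance.
Qed.

Program Definition holim_act S F m n (a : dmap m n) (u : holim_simp S F n) :
  holim_simp S F m :=
  @HolimSimp S F m (fun c Sc =>
    @SMap (sprod (nerve_over S c) (Delta m)) (F c)
      (fun p z => u c Sc p (z.1, dcomp a z.2)) _) _.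
Next Obligation.
move=> S F m n a u c Sc p q b [x s] /=.
rewrite -(snat (u c Sc) b) /=; congr (u c Sc p (_, _)); exact: dmapP.
Qed.
Next Obligation. by move=> *; exact: hnat. Qed.

Program Definition holim S F : sSet :=
  @SSet (holim_simp S F) (@holim_act S F) _ _.
Next Obligation.
move=> S F n u; apply: holim_simpP => c Sc p x s /=.
by congr (u c Sc p (_, _)); exact: dmapP.
Qed.
Next Obligation.
move=> S F l m n g f u; apply: holim_simpP => c Sc p x s /=.
by congr (u c Sc p (_, _)); exact: dmapP.
Qed.

Program Definition holim_sub S S' F (sS : S' `<=` S) :
  smap (holim S F) (holim S' F) :=
  @SMap (holim S F) (holim S' F) (fun n u =>
    @HolimSimp S' F n (fun c Sc =>
      @SMap (sprod (nerve_over S' c) (Delta n)) (F c)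
        (fun p z => u c (sS _ Sc) p (chain_map sS (lexx c) z.1, z.2)) _) _) _.
Next Obligation.
move=> S S' F sS n u c Sc p q b [x s] /=.
by rewrite -(snat (u c _) b) /=; congr (u c _ p (_, _)); exact: chainP.
Qed.
Next Obligation.
move=> S S' F sS n u c c' Sc Sc' h p x s /=.
rewrite -(hnat u (sS _ Sc) (sS _ Sc') h) /=.
by congr (u c' _ p (_, _)); exact: chainP.
Qed.
Next Obligation. by move=> *; exact: holim_simpP. Qed.

Program Definition holim_map S F G (t : nattrans F G) :
  smap (holim S F) (holim S G) :=
  @SMap (holim S F) (holim S G) (fun n u =>
    @HolimSimp S G n (fun c Sc => scompose (t c) (u c Sc)) _) _.
Next Obligation. by move=> S F G t n u *; rewrite /= -nnat hnat. Qed.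
Next Obligation. by move=> *; exact: holim_simpP. Qed.

(* The map X -> lim_S F -> holim_S F defined by a compatible family of maps. *)
Program Definition holim_cone S F (X : sSet)
    (f : forall c, S c -> smap X (F c))
    (fc : forall (c c' : C) (Sc : S c) (Sc' : S c') (h : (c' <= c)%O) n
       (x : X n), f c' Sc' n x = fres F h n (f c Sc n x)) :
  smap X (holim S F) :=
  @SMap X (holim S F) (fun n x =>
    @HolimSimp S F n (fun c Sc =>
      @SMap (sprod (nerve_over S c) (Delta n)) (F c)
        (fun p z => f c Sc p (sact z.2 x)) _) _) _.
Next Obligation.
by move=> S F X f fc n x c Sc p q b [y s] /=; rewrite sact_comp snat.
Qed.
Next Obligation. by move=> S F X f fc n x c c' Sc Sc' h p y s /=; exact: fc. Qed.
Next Obligation.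
move=> S F X f fc m n a x; apply: holim_simpP => c Sc p y s /=.
by rewrite sact_comp.
Qed.

(* The restriction maps are the restrictions along Q U `<=` Q V. *)
Program Definition holim_presheaf d' (D : porderType d') (Q : D -> set C)
    (Qmono : forall U V, (U <= V)%O -> Q U `<=` Q V) F : presheaf D :=
  @Presheaf d' D (fun U => holim (Q U) F)
    (fun U V h => holim_sub F (Qmono U V h)) _ _.
Next Obligation.
move=> d' D Q Qmono F U h n u; apply: holim_simpP => c Sc p x s /=.
rewrite (Prop_irrelevance (Qmono U U h c Sc) Sc).
by congr (u c _ p (_, _)); exact: chainP.
Qed.
Next Obligation.
move=> d' D Q Qmono F U V W h h' h'' n u; apply: holim_simpP => c Sc p x s /=.
rewrite (Prop_irrelevance (Qmono V W h' _ _) (Qmono U W h'' c Sc)).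
by congr (u c _ p (_, _)); exact: chainP.
Qed.

End Holim.

Section Smooth.
Variable R : realType.

Fixpoint Cr (r : nat) n k (O : set 'rV[R]_n) (g : 'rV[R]_n -> 'rV[R]_k) : Prop :=
  if r is r'.+1 then
    (forall x, O x -> differentiable g x) /\
    (forall v : 'rV[R]_n, Cr r' O (fun x => 'D_v g x))
  else forall x, O x -> {for x, continuous g}.

Definition Cinfty n k (O : set 'rV[R]_n) (g : 'rV[R]_n -> 'rV[R]_k) :=
  forall r, Cr r O g.

(* The values of [cmap] outside [cdom] are irrelevant. *)
Record chart (T : Type) := Chart {
  cdim : nat;
  cdom : set T;
  cmap : T -> 'rV[R]_cdim }.

(* In the charts [c] and [c'], the restriction of [f] to the subset [A] is
   defined around [x] and extends to a smooth map on a neighbourhood of x in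
   the Euclidean space. *)
Definition smooth_near T T' (c : chart T) (c' : chart T') (A : set T)
    (f : T -> T') (x : T) :=
  [/\ cdom c x, cdom c' (f x) &
    exists (O : set 'rV[R]_(cdim c)) (g : 'rV[R]_(cdim c) -> 'rV[R]_(cdim c')),
      [/\ open O, O (cmap c x), Cinfty O g &
        forall y, A y -> cdom c y -> O (cmap c y) ->
          cdom c' (f y) /\ cmap c' (f y) = g (cmap c y)]].

Definition smooth_on T T' (AT : set (chart T)) (AT' : set (chart T'))
    (A : set T) (f : T -> T') :=
  forall x, A x -> exists c c', [/\ AT c, AT' c' & smooth_near c c' A f x].

Definition half_space n : set 'rV[R]_n :=
  [set x | forall i : 'I_n, i = 0%N :> nat -> 0 <= x ord0 i].

(* [c] is a homeomorphism from an open set of T onto a relatively open subset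
   of R^n or of a half-space of R^n. *)
Definition is_chart (T : topologicalType) (c : chart T) :=
  [/\ open (cdom c), {within cdom c, continuous (cmap c)},
      (forall x y, cdom c x -> cdom c y -> cmap c x = cmap c y -> x = y) &
      exists2 B, B = setT \/ B = @half_space (cdim c) &
        forall W, open W -> W `<=` cdom c ->
          exists2 O, open O & cmap c @` W = O `&` B].

(* Smooth manifold of dimension n, with possibly empty boundary. *)
Definition is_manifold (T : topologicalType) (n : nat) (AT : set (chart T)) :=
  [/\ hausdorff_space T, @second_countable T,
      (forall x, exists2 c, AT c & cdom c x),
      (forall c, AT c -> is_chart c /\ cdim c = n) &
      forall c c', AT c -> AT c' -> forall x, cdom c x -> cdom c' x ->
        smooth_near c c' (cdom c') id x].

Record manifold := Manifold {
  mcar :> topologicalType;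
  atlas : set (chart mcar);
  mdim : nat;
  manifoldP : is_manifold mdim atlas }.

Definition diffeo T T' (AT : set (chart T)) (AT' : set (chart T'))
    (A : set T) (B : set T') (f : T -> T') :=
  [/\ smooth_on AT AT' A f, f @` A = B &
    exists2 g : T' -> T, smooth_on AT' AT B g & forall x, A x -> g (f x) = x].

(* [f] restricts to an embedding of [A] into [B]: a diffeomorphism onto its
   image. The values of [f] outside [A] are irrelevant. *)
Definition embedding T (AT : set (chart T)) (A B : set T) (f : T -> T) :=
  f @` A `<=` B /\ diffeo AT AT A (f @` A) f.

Definition cyl_chart T (c : chart T) : chart (T * R) :=
  @Chart (T * R)%type (cdim c + 1) [set z | cdom c z.1]
    (fun z => row_mx (cmap c z.1) (const_mx z.2)).

Definition cyl_atlas T (AT : set (chart T)) : set (chart (T * R)) :=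
  cyl_chart (T:=T) @` AT.

Definition isotopic T (AT : set (chart T)) (A : set T) (f g : T -> T) :=
  exists H : T * R -> T,
  [/\ smooth_on (cyl_atlas AT) AT [set z | A z.1 /\ 0 <= z.2 <= 1] H,
      (forall x, A x -> H (x, 0) = f x /\ H (x, 1) = g x) &
      forall t : R, 0 <= t <= 1 -> embedding AT A A (fun x => H (x, t))].

Definition isotopy_equiv T (AT : set (chart T)) (U V : set T) :=
  U `<=` V /\ exists e : T -> T,
    [/\ embedding AT V U e, isotopic AT V e id & isotopic AT U e id].

Definition euclid_atlas n : set (chart 'rV[R]_n) :=
  [set Chart setT (fun x : 'rV[R]_n => x)].

Definition euclid_ball n : set 'rV[R]_n := [set x | \sum_i x ord0 i ^+ 2 < 1].

Definition at_most_balls (T : topologicalType) (AT : set (chart T)) (k : nat)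
    (V : set T) :=
  exists2 n, (n <= k)%N & exists B : 'I_n -> set T,
    [/\ V = \bigcup_i B i, trivIset setT B &
      forall i, open (B i) /\
        exists (e : nat) (f : T -> 'rV[R]_e),
          diffeo AT (@euclid_atlas e) (B i) (@euclid_ball e) f].

End Smooth.

Definition opens (T : topologicalType) := {U : set T | `[< open U >]}.

HB.instance Definition _ (T : topologicalType) := SubChoice.on (opens T).
HB.instance Definition _ (T : topologicalType) :=
  [SubChoice_isSubPOrder of opens T by <: with set_display].

Lemma leopE (T : topologicalType) (U V : opens T) :
  (U <= V)%O = `[< val U `<=` val V >].
Proof. by rewrite -Order.le_val; apply/idP/asboolP => [/subsetPset|/subsetPset]. Qed.

Lemma leopP (T : topologicalType) (U V : opens T) :
  (U <= V)%O <-> val U `<=` val V.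
Proof. by rewrite leopE; split=> /asboolP. Qed.

Definition mkopens (T : topologicalType) (U : set T) (oU : open U) : opens T :=
  exist _ U (asboolT oU).

Lemma opensP (T : topologicalType) (U : opens T) : open (val U).
Proof. by case: U => U /= /asboolP. Qed.

Definition opens_top (T : topologicalType) : opens T := mkopens openT.

Definition opens_bigcup (T : topologicalType) (U : nat -> opens T) : opens T :=
  mkopens (bigcup_open (D := setT) (fun i _ => opensP (U i))).

Section Good.
Variables (T : topologicalType).

Lemma opens_bigcup_ub (U : nat -> opens T) i : (U i <= opens_bigcup U)%O.
Proof. by apply/leopP => x Ux; exists i. Qed.

Variable F : presheaf (opens T).

Program Definition seq_presheaf (U : nat -> opens T)
    (Umono : forall i j : nat, (i <= j)%O -> (U i <= U j)%O) : presheaf nat :=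
  @Presheaf _ nat (fun i => F (U i)) (fun i j h => fres F (Umono i j h)) _ _.
Next Obligation. by move=> *; exact: fres_id. Qed.
Next Obligation. by move=> *; exact: fres_comp. Qed.

Program Definition bigcup_to_holim (U : nat -> opens T)
    (Umono : forall i j : nat, (i <= j)%O -> (U i <= U j)%O) :
  smap (F (opens_bigcup U)) (holim [set: nat] (seq_presheaf Umono)) :=
  @holim_cone _ nat [set: nat] (seq_presheaf Umono) _
    (fun i _ => fres F (opens_bigcup_ub U i)) _.
Next Obligation.
by move=> U Umono i j _ _ ij n x /=; rewrite (fres_comp _ _ (opens_bigcup_ub U j)).
Qed.

Record good (R : realType) (AT : set (chart R T)) : Prop := Good {
  good_isotopy : forall (U V : opens T) (UV : (U <= V)%O),
    isotopy_equiv AT (val U) (val V) -> homotopy_equiv (fres F UV);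
  good_bigcup : forall (U : nat -> opens T)
    (Umono : forall i j : nat, (i <= j)%O -> (U i <= U j)%O),
    weak_equiv (bigcup_to_holim Umono) }.

End Good.

Section SingleVariable.
Variables (R : realType) (T : topologicalType) (AT : set (chart R T)).

Definition Ok (k : nat) (U : opens T) : set (opens T) :=
  [set V | (V <= U)%O /\ at_most_balls AT k (val V)].

Lemma Ok_mono k (U V : opens T) : (U <= V)%O -> Ok k U `<=` Ok k V.
Proof. by move=> UV W [WU]; split => //; exact: le_trans WU UV. Qed.

Definition Tk (k : nat) (F : presheaf (opens T)) : presheaf (opens T) :=
  holim_presheaf (@Ok_mono k) F.

End SingleVariable.

Section Coproduct.
Variables (R : realType) (m : nat) (P : 'I_m -> manifold R).

Definition coprod : topologicalType := {i : 'I_m & P i}.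

Definition coprod_chart i (c : chart R (P i)) : chart R coprod :=
  @Chart R coprod (cdim c) (existT _ i @` cdom c) (untag 0 (cmap c)).

(* The atlas of the disjoint union, whose charts need not have the same
   dimension. *)
Definition coprod_atlas : set (chart R coprod) :=
  [set c | exists i, exists2 c' : chart R (P i), atlas c' & c = coprod_chart c'].

Definition part (U : opens coprod) (i : 'I_m) : opens (P i) :=
  mkopens ((sigT_openP _).1 (opensP U) i).

Lemma part_mono (U V : opens coprod) i : (U <= V)%O -> (part U i <= part V i)%O.
Proof. by move=> /leopP UV; apply/leopP => x /UV. Qed.

(* O_j(U), a full subposet of O(coprod) through the identification of
   O(coprod) with the product of the O(P_i). *)
Definition Oj (j : m.-tupleprod nat) (U : opens coprod) : set (opens coprod) :=
  [set V | forall i, Ok (atlas (m := P i)) (tnth j i) (part U i) (part V i)].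

Lemma Oj_mono (j j' : m.-tupleprod nat) (U U' : opens coprod) :
  (j <= j')%O -> (U <= U')%O -> Oj j U `<=` Oj j' U'.
Proof.
rewrite leEtprod => /forallP jj' UU' V hV i; have [VU [n nj hn]] := hV i.
split; first exact: le_trans VU (part_mono i UU').
by exists n => //; apply: leq_trans nj _; have := jj' i; rewrite leEnat.
Qed.

Lemma untag_existT (A : Type) (a : A) i (f : P i -> A) (x : P i) :
  untag a f (existT _ i x : coprod) = f x.
Proof. by rewrite (untagE _ _ (erefl : tag (existT _ i x : coprod) = i)). Qed.

Lemma coprod_diffeo i (B : set (P i)) e (C : set 'rV[R]_e) f :
  diffeo (atlas (m := P i)) (@euclid_atlas R e) B C f ->
  diffeo coprod_atlas (@euclid_atlas R e) (existT _ i @` B : set coprod) C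
    (untag 0 f).
Proof.
move=> [fs fB [g gs gK]]; split.
- move=> _ [x Bx <-]; have [c [c' [hc hc1 [cx cx1 [W [h [oW Wx hs hh]]]]]]] := fs x Bx.
  exists (coprod_chart c), c'; split => //; first by exists i, c.
  split => /=; [by exists x | by rewrite untag_existT|].
  exists W, h; split => //=; first by rewrite untag_existT.
  move=> _ [y By <-] [z cz zy]; have yz := eq_from_Tagged zy; subst z.
  rewrite !untag_existT => Wz; apply: hh => //.
- rewrite -fB eqEsubset; split => [_ [_ [x Bx <-] <-]|_ [x Bx <-]].
    by rewrite untag_existT; exists x.
  by exists (existT _ i x); [exists x|rewrite untag_existT].
- exists (fun x => existT _ i (g x)).
  + move=> x Cx; have [c [c' [hc hc1 [cx cx1 [W [h [oW Wx hs hh]]]]]]] := gs x Cx.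
    exists c, (coprod_chart c'); split => //; first by exists i, c'.
    split => //=; first by exists (g x).
    exists W, h; split => //= y Cy cy Wy; have [? ?] := hh y Cy cy Wy.
    by split; [exists (g y)|rewrite untag_existT].
  + by move=> _ [x Bx <-]; rewrite untag_existT gK.
Qed.

Lemma Oj_sub_Ok k (j : m.-tupleprod nat) (U : opens coprod) :
  (\sum_(i < m) tnth j i <= k)%N -> Oj j U `<=` Ok coprod_atlas k U.
Proof.
move=> jk V hV; split.
  by apply/leopP => -[i x] Vx; have [/leopP + _] := hV i; apply.
have hn i := cid2 (hV i).2; pose n i := s2val (hn i).
have hB i := cid (s2valP' (hn i)); pose B i : 'I_(n i) -> set (P i) := sval (hB i).
pose J := {i : 'I_m & 'I_(n i)}.
exists #|{: J}|.
  rewrite card_tagged sumnE big_map big_enum /=; apply: leq_trans jk.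
  by apply: leq_sum => i _; rewrite card_ord; exact: s2valP (hn i).
pose B' (u : J) : set coprod := existT _ (tag u) @` B (tag u) (tagged u).
exists (fun r => B' (enum_val r)); split.
- rewrite eqEsubset; split => [[i x] Vx|[i x] [r _]].
    have [VB _ _] := svalP (hB i).
    have : (\bigcup_l B i l) x by rewrite -VB.
    move=> [l _ Bx]; exists (enum_rank (existT _ i l : J)) => //.
    by rewrite enum_rankK; exists x.
  move: (enum_val r) => [i' l] [y By e].
  have [VB _ _] := svalP (hB i').
  have : val (part V i') y by rewrite VB; exists l.
  by rewrite /= e.
- apply/trivIsetP => r s _ _ rs; rewrite -subset0 => z [].
  have {rs} : enum_val r != enum_val s by apply: contra_neq rs => /enum_val_inj.
  move: (enum_val r) (enum_val s) => [i l] [i' l'] ne [x Bx <-] [y By e].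
  have ii : i' = i by case: e.
  subst i'; have yx := eq_from_Tagged e; subst y.
  have [_ /trivIsetP tB _] := svalP (hB i).
  have /tB : l != l' by apply: contra_neq ne => ->.
  by move=> /(_ I I) h; suff : set0 x by []; rewrite -h.
- move=> r; move: (enum_val r) => [i l].
  have [_ _ /(_ l) [oB [e [f df]]]] := svalP (hB i).
  split; first exact: existT_open_map.
  by exists e, (untag 0 f); exact: coprod_diffeo.
Qed.

Variable F : presheaf (opens coprod).

Definition Tj (j : m.-tupleprod nat) : presheaf (opens coprod) :=
  holim_presheaf (fun U V => @Oj_mono j j U V (lexx j)) F.

(* j |-> T_j F (U), with the canonical restriction maps. *)
Definition Tj_diagram (U : opens coprod) : presheaf (m.-tupleprod nat) :=
  holim_presheaf (fun j j' jj' => @Oj_mono j j' U U jj' (lexx U)) F.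

Program Definition Tj_diagram_res (U V : opens coprod) (UV : (U <= V)%O) :
  nattrans (Tj_diagram V) (Tj_diagram U) :=
  @NatTrans _ _ (Tj_diagram V) (Tj_diagram U) (fun j => fres (Tj j) UV) _.
Next Obligation.
move=> U V UV j j' jj' n u; apply: holim_simpP => c Sc p x s /=.
rewrite (Prop_irrelevance (Oj_mono jj' _ _) (Oj_mono _ UV (Oj_mono jj' (lexx U) Sc))).
by congr (u c _ p (_, _)); exact: chainP.
Qed.

Definition total_le (k : nat) : set (m.-tupleprod nat) :=
  [set j | (\sum_(i < m) tnth j i <= k)%N].

Program Definition holim_Tj (k : nat) : presheaf (opens coprod) :=
  @Presheaf _ _ (fun U => holim (total_le k) (Tj_diagram U))
    (fun U V UV => holim_map (total_le k) (Tj_diagram_res UV)) _ _.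
Next Obligation.
move=> k U h n u; apply: holim_simpP => j Sj p x s /=.
exact: (fres_id (p := Tj j)).
Qed.
Next Obligation.
move=> k U V W h h' h'' n u; apply: holim_simpP => j Sj p x s /=.
exact: (fres_comp (p := Tj j)).
Qed.

(* The canonical map, with components the restrictions T_k F (U) -> T_j F (U)
   along the inclusions of O_j(U) in O_k(U). *)
Program Definition Tk_to_holim_Tj (k : nat) :
  nattrans (Tk coprod_atlas k F) (holim_Tj k) :=
  @NatTrans _ _ (Tk coprod_atlas k F) (holim_Tj k) (fun U =>
    @holim_cone _ _ (total_le k) (Tj_diagram U) (Tk coprod_atlas k F U)
      (fun j jk => holim_sub F (@Oj_sub_Ok k j U jk)) _) _.
Next Obligation.
move=> k U j j' Sj Sj' jj' n u; apply: holim_simpP => c Sc p x s /=.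
rewrite (Prop_irrelevance (Oj_sub_Ok Sj' Sc)
  (Oj_sub_Ok Sj (Oj_mono jj' (lexx U) Sc))).
by congr (u c _ p (_, _)); exact: chainP.
Qed.
Next Obligation.
move=> k U V UV n u; apply: holim_simpP => j Sj p x s /=.
apply: holim_simpP => c Sc q y t /=.
rewrite (Prop_irrelevance (Ok_mono UV _) (Oj_sub_Ok Sj (Oj_mono (lexx j) UV Sc))).
by congr (u c _ q (_, _)); exact: chainP.
Qed.

End Coproduct.

(* Main.v *)
Require Import Defs.
From mathcomp Require Import all_boot all_order all_algebra.
From mathcomp Require Import all_classical all_reals all_analysis.

(* Write t(V) for the numbers of balls of V in O_k(U) in the various P_i, and G
   for the poset of pairs (j, V) with V in O_j(U) and |j| <= k. The iterated
   homotopy limit consists of natural families indexed by the chains of G all of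
   whose open sets lie in all the O_j of the chain. In the mapping cylinder of
   the projection G -> O_k(U), consider chains made of such a chain of G followed
   by a chain of O_k(U), and the space W of families indexed by them. The
   restrictions of W to the chains of O_k(U) and to the chains of G are both
   trivial fibrations; pulling back along the projection of the cylinder is a
   section of the first one, whose composite with the second one is the map of
   the theorem.
   Each trivial fibration is obtained by discrete Morse theory: outside the
   subcomplex to extend from, the simplices are matched by adding or removing one
   vertex, so that the extension is a succession of horn fillings in the Kan
   complexes F(V). For the second one, the matching contracts the poset of the
   (j, W) with V <= W along (j, W) >= (j, W') >= (min(j, t(V)), W') <= (t(V), W')
   >= (t(V), V), where W' is the union of the balls of W that meet V; each of them
   contains a ball of V, so that W' is in O_t(V). *)

Set Implicit Arguments.
Unset Strict Implicit.
Unset Printing Implicit Defensive.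

Import Order.TTheory GRing.Theory Num.Theory.
Import numFieldNormedType.Exports.

Local Open Scope classical_set_scope.
Local Open Scope ring_scope.

(** * Extension of natural families along a discrete Morse matching *)

(** The value on a chain lives in [F] of its last, smallest open set. A horn is therefore filled in
    [F] of the last vertex of the simplex, and the filler gives a value on the missing facet only if
    that facet still ends over a set that is no larger. This is why each pivot comes with a second
    vertex whose open set is contained in that of the pivot: a pair with the same open set in one
    matching, an element of O_k(U) below all the pairs in the other. The zigzag has its shape
    because j and t(V) are incomparable in general and their join may have a total above k, which
    imposes the detour by min(j, t(V)). Moreover W may have balls that miss V, hence fail to be in
    O_t(V), so W has to shrink before the index moves. The only arrow of the zigzag that goes up is
    also the only one for which the pivot is chosen at the other end of the chain. The complexes are
    infinite. Zorn's lemma organizes the fillings, and the measure only selects the next horn. *)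

Section Extension.
Context {d : Order.disp_t} {C : porderType d} (F : presheaf C).
Context (D : choiceType) (ge : D -> D -> Prop) (rho : D -> C).
Hypothesis F_kan : space_valued F.
Hypothesis ge_refl : forall x, ge x x.
Hypothesis ge_anti : forall x y, ge x y -> ge y x -> x = y.
Hypothesis ge_trans : forall y x z, ge x y -> ge y z -> ge x z.
Hypothesis rho_ge : forall x y, ge x y -> (rho y <= rho x)%O.

Definition antitone p (x : 'I_p.+1 -> D) :=
  forall i j : 'I_p.+1, (i <= j)%N -> ge (x i) (x j).

Definition chain_set (A : set D) :=
  [/\ finite_set A, A !=set0 & forall x y, A x -> A y -> ge x y \/ ge y x].

Lemma antitone_comp p q (x : 'I_p.+1 -> D) (a : dmap q p) :
  antitone x -> antitone (fun i => x (a i)).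
Proof. by move=> xm i j ij; apply: xm; exact: dmono. Qed.

Lemma rho_antitone p (x : 'I_p.+1 -> D) i :
  antitone x -> (rho (x ord_max) <= rho (x i))%O.
Proof. by move=> xm; apply/rho_ge/xm; rewrite leq_ord. Qed.

Lemma chain_set_enum A : chain_set A ->
  exists p (t : 'I_p.+1 -> D), [/\ antitone t, injective t & range t = A].
Proof.
move=> [/finite_seqP[s0 As0] [x0 Ax0] Atot].
pose leT x y := `[< ge x y >].
pose s := sort leT (undup s0).
have sA x : x \in s <-> A x by rewrite mem_sort mem_undup As0.
have sum : uniq s by rewrite sort_uniq undup_uniq.
have ss : sorted leT s.
  apply: (@sort_sorted_in _ [in A] leT).
    move=> x y /set_mem Ax /set_mem Ay; apply/orP.
    by have [?|?] := Atot x y Ax Ay; [left|right]; apply/asboolP.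
  by apply/allP => x; rewrite mem_undup => xs; apply/mem_set; rewrite As0.
have : (0 < size s)%N by rewrite lt0n size_eq0; apply/eqP => s0e; have /sA := Ax0; rewrite s0e.
case E : (size s) => [//|p] _.
exists p, (fun i => nth x0 s i); split.
- move=> i j ij; apply/asboolP.
  have lt_trans : transitive leT.
    by move=> y x z /asboolP xy /asboolP yz; apply/asboolP; exact: ge_trans yz.
  have lt_refl : reflexive leT by move=> x; apply/asboolP.
  by apply: (sorted_leq_nth lt_trans lt_refl x0 ss) => //; rewrite inE E.
- move=> i j /eqP; rewrite nth_uniq ?E // => /eqP; exact: val_inj.
- rewrite eqEsubset; split => [_ [i _ <-]|x /sA xs].
    by apply/sA; rewrite mem_nth ?E.
  have ip : (index x s < p.+1)%N by rewrite -E index_mem.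
  by exists (Ordinal ip) => //=; rewrite nth_index.
Qed.

Lemma antitone_factor p q (t : 'I_q.+1 -> D) (x : 'I_p.+1 -> D) :
  antitone t -> injective t -> antitone x -> range x `<=` range t ->
  exists a : dmap p q, forall i, x i = t (a i).
Proof.
move=> tm ti xm xt.
have /choice[a ha] i : exists k, x i = t k.
  by have [|k _ <-] := xt (x i); [exists i|exists k].
have am (i j : 'I_p.+1) : (i <= j)%N -> (a i <= a j)%N.
  move=> ij; rewrite leqNgt; apply/negP => ji.
  have e : x i = x j by apply: ge_anti (xm _ _ ij) _; rewrite !ha; exact/tm/ltnW.
  by move: ji; rewrite (ti (a i) (a j)) ?ltnn // -!ha.
by exists (DMap am).
Qed.

(** A relation and not a function: the union of a chain of partial sections and the addition of two
    simplices are then plain disjunctions, without transport between types of values. *)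
Definition prel := forall p (x : 'I_p.+1 -> D), F (rho (x ord_max)) p -> Prop.

(* [R] is the graph of a section of [F], natural in the simplices, over the
   chains whose set of vertices is in [T]. *)
Record psection (T : set (set D)) (R : prel) : Prop := PSection {
  ps_dom : forall p (x : 'I_p.+1 -> D) v, R p x v -> antitone x /\ T (range x);
  ps_ex : forall p (x : 'I_p.+1 -> D), antitone x -> T (range x) -> exists v, R p x v;
  ps_fun : forall p (x : 'I_p.+1 -> D) v w, R p x v -> R p x w -> v = w;
  ps_nat : forall p q (x : 'I_p.+1 -> D) (a : dmap q p) v w
    (h : (rho (x ord_max) <= rho (x (a ord_max)))%O),
    R p x v -> R q (fun i => x (a i)) w -> fres F h q w = sact a v }.

Definition prel_sub (R R' : prel) := forall p x v, R p x v -> R' p x v.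

Definition down_closed (T : set (set D)) :=
  forall A B, A `<=` B -> A !=set0 -> T B -> T A.

Lemma range_dmap p q (x : 'I_p.+1 -> D) (a : dmap q p) :
  range (fun i => x (a i)) `<=` range x.
Proof. by move=> _ [i _ <-]; exists (a i). Qed.

Lemma range_neq0 p (x : 'I_p.+1 -> D) : range x !=set0.
Proof. by exists (x ord0), ord0. Qed.

(** All the facets of [A] are in [T] except the one opposite [v]: this is a horn, filled in [F] of
    the last vertex of [A]. The new values are on [A] and on the missing facet. The vertex [q] makes
    that facet end over a set no larger than the last one of [A], so that the filler restricts to
    it. *)
Lemma psection_horn (T : set (set D)) R A v q :
  down_closed T -> psection T R -> chain_set A ->
  A v -> A q -> q <> v -> (rho q <= rho v)%O ->
  (forall w, A w -> w <> v -> T (A `\ w)) -> ~ T (A `\ v) ->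
  exists2 R', psection (T `|` [set A; A `\ v]) R' & prel_sub R R'.
Proof.
move=> Td Rs Ac Av Aq qv rqv TA TnA.
have [n [t [tm ti tA]]] := chain_set_enum Ac.
have [k _ tk] : range t v by rewrite tA.
have [k' _ tk'] : range t q by rewrite tA.
case: n t tm ti tA k tk k' tk' => [|n] t tm ti tA k tk k' tk'.
  by case: qv; rewrite -tk -tk' !ord1.
(* [k] is the position of [v], so a simplex of the horn misses some vertex other than [v]. *)
have hT p (s : dmap p n.+1) : in_horn k s -> T (range (fun i => t (s i))).
  move=> [i ik hi]; apply: (Td _ (A `\ t i)); last 1 first.
  - by apply: TA; [rewrite -tA; exists i|rewrite -tk => /ti].
  - move=> _ [j _ <-]; split; first by rewrite -tA; exists (s j).
    by move=> /ti /hi.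
  - exact: range_neq0.
have hR p (s : horn k p) := cid (ps_ex Rs (antitone_comp (sval s) tm) (hT _ _ (svalP s))).
(* All values are restricted to the last vertex of [A], so that the horn maps to a single Kan
   complex. *)
pose hv p (s : horn k p) := fres F (rho_antitone (sval s ord_max) tm) p (sval (hR p s)).
have hn p q' (a : dmap p q') (s : horn k q') : hv p (sact a s) = sact a (hv q' s).
  rewrite /hv -(snat (fres F _)) /=.
  set le1 := rho_antitone _ _; set le2 := rho_antitone _ _.
  have le3 : (rho (t (sval s ord_max)) <= rho (t (sval s (a ord_max))))%O.
    by apply/rho_ge/tm/dmono; exact: leq_ord.
  rewrite -(ps_nat Rs le3 (svalP (hR q' s)) (svalP (hR p (sact a s)))).
  by rewrite (fres_comp le2 le3 le1).
have [g hg] := @F_kan _ _ k (SMap hn).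
(* A chain outside [T] factors through the enumeration [t] of [A]; it takes the value of the filler
   on the factorization, restricted to its own last vertex. *)
pose R' : prel := fun p x u => R p x u \/ (~ T (range x) /\
  exists (a : dmap p n.+1) (le : (rho (x ord_max) <= rho (t ord_max))%O),
    (forall i, x i = t (a i)) /\ u = fres F le p (g p a)).
have big p (x : 'I_p.+1 -> D) (a : dmap p n.+1) : (forall i, x i = t (a i)) ->
    ~ T (range x) -> A `\ v `<=` range x.
  move=> xa nTx w [Aw wv]; apply: contrapT => xw; apply: nTx.
  apply: (Td _ (A `\ w)); [|exact: range_neq0|exact: TA].
  move=> _ [i _ <-]; split; first by rewrite -tA xa; exists (a i).
  by move=> xiw; apply: xw; exists i.
exists R'; last by move=> p x u; left.
split.
- move=> p x u [/(ps_dom Rs)[xm Tx]|[nTx [a [_ [xa _]]]]]; first by split=> //; left.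
  have e : x = (fun i => t (a i)) by apply/funext.
  have AB := big p x a xa nTx.
  split; first by rewrite e; exact: antitone_comp.
  right; have [xv|xv] := pselect (range x v); [left|right]; rewrite /= eqEsubset; split.
  + by rewrite e => _ [i _ <-]; rewrite -tA; exists (a i).
  + move=> w Aw; have [->//|wv] := pselect (w = v); exact: AB.
  + rewrite e => _ [i _ <-]; split; first by rewrite -tA; exists (a i).
    by move=> /= iv; apply: xv; exists i => //; rewrite xa.
  + exact: AB.
- move=> p x xm T'x; have [Tx|nTx] := pselect (T (range x)).
    by have [u Ru] := ps_ex Rs xm Tx; exists u; left.
  have xA : range x `<=` A by case: T'x => // -[->|->] // w [].
  have Ax : A `\ v `<=` range x by case: T'x => // -[->|->] // w [].
  have [a xa] := antitone_factor tm ti xm (eq_ind_r (fun B => range x `<=` B) xA tA).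
  have le : (rho (x ord_max) <= rho (t ord_max))%O.
    (* If [v] is the last vertex of [A], the chain still passes through [q], over a set contained in
       that of [v]. *)
    have [e|tv] := pselect (t ord_max = v).
      have [i _ iq] := Ax q (conj Aq qv).
      by apply: le_trans (rho_antitone i xm) _; rewrite iq e.
    have [|i _ <-] := Ax (t ord_max); last exact: rho_antitone.
    by split => //; rewrite -tA; exists ord_max.
  by exists (fres F le p (g p a)); right; split => //; exists a, le.
- move=> p x u w [Ru|[nTx [a [le [xa ->]]]]] [Rw|[nTx' [a' [le' [xa' ->]]]]].
  + exact: ps_fun Rs _ _ _ _ Ru Rw.
  + by have [_ /nTx'] := ps_dom Rs Ru.
  + by have [_ /nTx] := ps_dom Rs Rw.
  + have -> : a = a' by apply: dmapP => i; apply: ti; rewrite -xa.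
    by rewrite (Prop_irrelevance le le').
- move=> p q' x b u w h [Ru|[nTx [a [le [xa ->]]]]] [Rw|[nTx' [a' [le' [xa' ->]]]]].
  + exact: ps_nat Rs _ _ _ _ _ _ h Ru Rw.
  + have [_ Tx] := ps_dom Rs Ru; case: nTx'.
    exact: Td (@range_dmap _ _ x b) (range_neq0 _) Tx.
  + have [_ Tw] := ps_dom Rs Rw.
    have e : x = (fun i => t (a i)) by apply/funext.
    subst x.
    (* A face that lies in [T] is in the horn: otherwise it would contain every vertex except
       possibly [v], which would put the missing facet in [T]. *)
    have ab : in_horn k (Defs.dcomp a b).
      apply: contrapT => nab; apply: TnA.
      apply: Td Tw; last by exists q.
      move=> z [Az zv]; have [i _ iz] : range t z by rewrite tA.
      have ik : i <> k by move=> e; apply: zv; rewrite /= -iz e.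
      apply: contrapT => zn; apply: nab; exists i => // j abj.
      by apply: zn; exists j => //; rewrite -iz -abj.
    pose s : horn k q' := exist _ (Defs.dcomp a b) ab.
    rewrite -(snat (fres F le)) -(snat g) 
      (hg _ s : g q' (@sact (Delta n.+1) _ _ b a) = hv q' s) /hv.
    rewrite (ps_fun Rs Rw (svalP (hR q' s))).
    set le1 := rho_antitone _ _; rewrite (fres_comp le le1 (le_trans le le1)).
    by rewrite (Prop_irrelevance h (le_trans le le1)).
  + have e : x = (fun i => t (a i)) by apply/funext.
    subst x.
    have -> : a' = Defs.dcomp a b by apply: dmapP => i; apply: ti; rewrite -xa'.
    by rewrite (fres_comp h le' le) -(snat (fres F le)) -(snat g).
Qed.

(* [K] collapses onto [K0]: outside [K0], adding or removing the vertex [pv A]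
   is a perfect matching of the simplices of [K], along which horns can be
   filled in the order of the lexicographic measure [(mu1, mu2)]. *)
Record collapse (K0 K : set (set D)) (pv : set D -> D) (mu1 mu2 : set D -> nat) :
  Prop := Collapse {
  col_chain : forall A, K A -> chain_set A;
  col_sub : K0 `<=` K;
  col_down0 : down_closed K0;
  col_down : down_closed K;
  col_add : forall A, K A -> ~ K0 A ->
    [/\ K (pv A |` A), pv (pv A |` A) = pv A,
        mu1 (pv A |` A) = mu1 A & mu2 (pv A |` A) = mu2 A];
  col_rem : forall A, K A -> ~ K0 A -> A (pv A) ->
    [/\ ~ K0 (A `\ pv A), pv (A `\ pv A) = pv A &
        exists q, [/\ A q, q <> pv A & (rho q <= rho (pv A))%O]];
  col_face : forall A w, K A -> ~ K0 A -> A (pv A) -> A w -> w <> pv A ->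
    ~ K0 (A `\ w) -> (mu1 (A `\ w) < mu1 A)%N \/
      (mu1 (A `\ w) = mu1 A /\ (mu2 (A `\ w) < mu2 A)%N) }.

(** * Extension along a collapse, by Zorn's lemma *)

Section Zorn.
Variables (K0 K : set (set D)) (pv : set D -> D) (mu1 mu2 : set D -> nat).
Hypothesis col : collapse K0 K pv mu1 mu2.

(** Together with down-closedness: [T] contains both members of a matched pair or neither, so that a
    missing pair can still be filled as a horn. *)
Definition saturated (T : set (set D)) := forall A, K A -> ~ K0 A -> A (pv A) ->
  T (A `\ pv A) -> T A.

Lemma lex_minimal (P : set (set D)) : P !=set0 -> exists2 A, P A &
  forall B, P B -> ~ ((mu1 B < mu1 A)%N \/ (mu1 B = mu1 A /\ (mu2 B < mu2 A)%N)).
Proof.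
move=> [A0 PA0].
have ex1 : exists n, `[< exists2 A, P A & mu1 A = n >] by exists (mu1 A0); apply/asboolP; exists A0.
case: (ex_minnP ex1) => n /asboolP[A1 PA1 A1n] nmin.
have ex2 : exists m, `[< exists2 A, P A & mu1 A = n /\ mu2 A = m >].
  by exists (mu2 A1); apply/asboolP; exists A1.
case: (ex_minnP ex2) => m /asboolP[A PA [An Am]] mmin.
exists A => // B PB [|[]]; rewrite An.
  by apply/negP; rewrite -leqNgt; apply: nmin; apply/asboolP; exists B.
move=> Bn; apply/negP; rewrite -leqNgt Am; apply: mmin; apply/asboolP; exists B => //.
Qed.

(** Completing a missing simplex [B] of least measure by its pivot gives the horn. Adding the pivot
    preserves the measure; the facets through the pivot are in [K0] or have a smaller measure, hence
    are in [T]; the facet opposite the pivot is not, by saturation. *)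
Lemma collapse_horn (T : set (set D)) : K0 `<=` T -> T `<=` K -> down_closed T ->
  saturated T -> ~ (K `<=` T) ->
  exists A, [/\ K A, ~ K0 A, A (pv A), ~ T (A `\ pv A) &
    forall w, A w -> w <> pv A -> T (A `\ w)].
Proof.
move=> KT0 TK Td Ts KT.
have [|B [KB nTB] Bmin] := @lex_minimal (K `\` T).
  by apply: contrapT => h; apply: KT => A KA; apply: contrapT => nTA; apply: h; exists A.
have nK0B : ~ K0 B by move=> /KT0.
have [KA pA m1 m2] := col_add col KB nK0B.
set A := pv B |` B in KA pA m1 m2.
have [q Bq] : B !=set0 by have [] := col_chain col KB.
have BA : B `<=` A by move=> x; right.
have nTA : ~ T A by move=> TA; apply/nTB/(Td _ _ BA) => //; exists q.
have nK0A : ~ K0 A by move=> /KT0.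
have Av : A (pv A) by rewrite pA; left.
exists A; split => //.
  by move=> /(Ts _ KA nK0A Av).
move=> w Aw wv; apply: contrapT => nTw.
have nK0w : ~ K0 (A `\ w) by move=> /KT0.
have /Bmin : (K `\` T) (A `\ w).
  split => //; apply: (col_down col _ _ KA); first by move=> x [].
  by exists (pv A); split => // /esym.
by rewrite -m1 -m2; apply; exact: (col_face col).
Qed.

Theorem psection_extend R0 : psection K0 R0 ->
  exists2 R, psection K R & prel_sub R0 R.
Proof.
move=> R0s.
pose ok (TR : set (set D) * prel) := [/\ K0 `<=` TR.1, TR.1 `<=` K, down_closed TR.1,
  saturated TR.1 & psection TR.1 TR.2 /\ prel_sub R0 TR.2].
have ok0 : ok (K0, R0).
  split => //=; [exact: col_sub col|exact: col_down0 col| |by split].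
  move=> A KA nKA Av /= KA0; have [+ _ _] := col_rem col KA nKA Av.
  by move=> /(_ KA0).
pose S := {TR | ok TR}.
pose le (a b : S) := (sval a).1 `<=` (sval b).1 /\ prel_sub (sval a).2 (sval b).2.
have [[[T R] okTR] max] : exists t : S, premaximal (fun a b => `[< le a b >]) t.
  apply: (ZL_preorder (exist _ _ ok0)).
  - by move=> a; apply/asboolP; split.
  - move=> b a c /asboolP[ab1 ab2] /asboolP[bc1 bc2]; apply/asboolP; split.
      exact: subset_trans bc1.
    by move=> p x v /ab2 /bc2.
  move=> Ch Chtot.
  have [[c0 Chc0]|Ch0] := pselect (exists c, Ch c); last first.
    by exists (exist _ _ ok0) => s Chs; case: Ch0; exists s.
  have tot a b : Ch a -> Ch b -> le a b \/ le b a.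
    by move=> Ca Cb; have [/asboolP|/asboolP] := Chtot a b Ca Cb; [left|right].
  pose T A := exists2 c, Ch c & (sval c).1 A.
  pose R p x v := exists2 c, Ch c & (sval c).2 p x v.
  have okT : ok (T, R).
    split => /=.
    - by move=> A KA; exists c0 => //; have [+ _ _ _ _] := svalP c0; apply.
    - by move=> A [c _]; have [_ + _ _ _] := svalP c; apply.
    - by move=> A B AB A0 [c Cc cB]; exists c => //; have [_ _ + _ _] := svalP c; apply; eauto.
    - move=> A KA nKA Av [c Cc cA]; exists c => //; have [_ _ _ + _] := svalP c; exact.
    split; first split.
      + move=> p x v [c Cc cR]; have [_ _ _ _ [cs _]] := svalP c.
        by have [xm cx] := ps_dom cs cR; split=> //; exists c.
      + move=> p x xm [c Cc cx]; have [_ _ _ _ [cs _]] := svalP c.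
        by have [v cv] := ps_ex cs xm cx; exists v, c.
      + move=> p x v w [c Cc cv] [e Ce ew].
        have [[_ le1]|[_ le1]] := tot _ _ Cc Ce.
          have [_ _ _ _ [cs _]] := svalP e; exact: ps_fun cs _ _ _ _ (le1 _ _ _ cv) ew.
        have [_ _ _ _ [cs _]] := svalP c; exact: ps_fun cs _ _ _ _ cv (le1 _ _ _ ew).
      + move=> p q x a v w h [c Cc cv] [e Ce ew].
        have [[_ le1]|[_ le1]] := tot _ _ Cc Ce.
          have [_ _ _ _ [cs _]] := svalP e; exact: ps_nat cs _ _ _ _ _ _ h (le1 _ _ _ cv) ew.
        have [_ _ _ _ [cs _]] := svalP c; exact: ps_nat cs _ _ _ _ _ _ h cv (le1 _ _ _ ew).
    + by move=> p x v R0v; exists c0 => //; have [_ _ _ _ [_ +]] := svalP c0; apply.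
  exists (exist _ _ okT) => s Cs; apply/asboolP; split => /= [A sA|p x v sv]; by exists s.
have [/= KT TK Td Ts [Rs R0R]] := okTR.
have [KsT|nKT] := pselect (K `<=` T).
  have -> : K = T by rewrite eqEsubset.
  by exists R.
have [A [KA nKA Av nTA TA]] := collapse_horn KT TK Td Ts nKT.
have [nKr pr [q [Aq qv rq]]] := col_rem col KA nKA Av.
have [R' R's RR'] := psection_horn Td Rs (col_chain col KA) Av Aq qv rq TA nTA.
have KAv : K (A `\ pv A) by apply: (col_down col _ _ KA); [move=> x []|exists q].
(* One more horn filling keeps the invariants and contradicts maximality. *)
have ok' : ok (T `|` [set A; A `\ pv A], R').
  split => //=.
  - by move=> B /KT; left.
  - by move=> B [/TK//|[->|->]].
  - move=> B B' BB' B0 [TB'|B'A]; first by left; exact: Td TB'.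
    have BA : B `<=` A.
      by apply: subset_trans BB' _; case: B'A => ->// x [].
    have [AB|nAB] := pselect (A `\ pv A `<=` B).
      right; have [Bv|Bv] := pselect (B (pv A)); [left|right]; rewrite /= eqEsubset; split => //.
        by move=> x Ax; have [->//|xv] := pselect (x = pv A); exact: AB.
      by move=> x Bx; split; [exact: BA|move=> /= xv; rewrite xv in Bx].
    (* A face of [A] that misses a vertex [w] other than the pivot is contained in a facet already
       in [T]. *)
    left; have [w [[Aw wv] nBw]] : exists w, (A `\ pv A) w /\ ~ B w.
      by apply: contrapT => h; apply: nAB => w Aw; apply: contrapT => nBw; apply: h; exists w.
    apply: (Td _ (A `\ w)) => //; last exact: TA.
    by move=> x Bx; split; [exact: BA|move=> /= xw; rewrite xw in Bx].
  (* If [B] without its pivot were [A], then [A] would have that same pivot without containing it.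
     If it is [A] without its pivot, the pivots coincide and [B] is [A]. *)
  - move=> B KB nKB Bv [TB|[BA|BA]]; first by left; exact: Ts.
      have [_ pB _] := col_rem col KB nKB Bv.
      by move: Av; rewrite -BA pB => -[_ []].
    have [_ pB _] := col_rem col KB nKB Bv.
    right; left; rewrite -[B](@setD1K _ (pv B)) // BA -pB BA pr.
    exact: setD1K.
  - by split=> // p x v /R0R /RR'.
have : `[< le (exist _ _ ok') (exist _ _ okTR) >].
  by apply: max; apply/asboolP; split => //= B; left.
move=> /asboolP[/= sub _]; case: nTA; apply: sub; right; right.
by [].
Qed.

End Zorn.
End Extension.

(** * Spans of trivial fibrations *)

Definition prism a b : sSet := sprod (Delta a) (Delta b).

Definition in_bd a b m (s : dmap m a * dmap m b) := ~ dsurj s.1 \/ ~ dsurj s.2.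

Lemma dsurj_compl l m n (s : dmap m n) (a : dmap l m) :
  dsurj (Defs.dcomp s a) -> dsurj s.
Proof. by move=> h i; have [j <-] := h i; exists (a j). Qed.

Lemma in_bd_act a b l m (c : dmap l m) (s : prism a b m) :
  in_bd s -> in_bd (sact c s).
Proof. by move=> [h|h]; [left|right] => /dsurj_compl. Qed.

Program Definition prism_bd a b : sSet :=
  @SSet (fun m => {s : prism a b m | in_bd s})
        (fun l m c s => exist _ (sact c (sval s)) (in_bd_act c (svalP s))) _ _.
Next Obligation.
move=> a b n [s hs]; apply: eq_sig_hprop => [*|]; first exact: Prop_irrelevance.
exact: (@sact_id (prism a b)).
Qed.
Next Obligation.
move=> *; apply: eq_sig_hprop => [*|]; first exact: Prop_irrelevance.
exact: (@sact_comp (prism _ _)).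
Qed.

(** The test inclusions are the boundaries of products of two simplices, because [rel_homotopic] is
    expressed by maps out of [Delta n] times [Delta 1]: no triangulation of the prism is needed. For
    [b = 0] the boundary is that of [Delta a]. *)
Definition trivial_fibration (X Y : sSet) (g : smap X Y) :=
  forall a b (u : smap (prism_bd a b) X) (v : smap (prism a b) Y),
    (forall m s, g m (u m s) = v m (sval s)) ->
  exists w : smap (prism a b) X,
    (forall m s, w m (sval s) = u m s) /\ (forall m s, g m (w m s) = v m s).

Lemma smap_cst (X Y : sSet) (g : smap X Y) x m : g m (Defs.cst x m) = Defs.cst (g _ x) m.
Proof. exact: snat. Qed.

Lemma sact_cst (X : sSet) (x : X 0%N) m n (a : dmap m n) : sact a (Defs.cst x n) = Defs.cst x m.
Proof. by rewrite /Defs.cst -sact_comp; congr (sact _ x); apply: dmapP. Qed.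

Lemma smap_spherical (X Y : sSet) (g : smap X Y) x n (a : X n) :
  spherical x a -> spherical (g _ x) (g _ a).
Proof. by move=> sa m s ns; rewrite -snat sa // smap_cst. Qed.

Lemma smap_rel_homotopic (X Y : sSet) (g : smap X Y) x n (a b : X n) :
  rel_homotopic x a b -> rel_homotopic (g _ x) (g _ a) (g _ b).
Proof.
move=> [h [h1 h2]]; exists (scompose g h); split => [m s|m s t ns] /=.
  by have [-> ->] := h1 m s; rewrite !snat.
by rewrite h2 // smap_cst.
Qed.

Lemma rel_homotopic_refl (X : sSet) (x : X 0%N) n (a : X n) :
  spherical x a -> rel_homotopic x a a.
Proof.
have hn m q (c : dmap m q) (s : sprod (Delta n) (Delta 1) q) :
  sact (sact c s).1 a = sact c (sact s.1 a) by rewrite /= sact_comp.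
move=> sa; exists (@SMap (sprod (Delta n) (Delta 1)) X (fun m s => sact s.1 a) hn).
by split => // m s t; exact: sa.
Qed.

Lemma dsurj0 m (s : dmap m 0) : dsurj s.
Proof. by move=> i; exists ord0; rewrite !ord1. Qed.

Lemma spherical0 (X : sSet) (x a : X 0%N) : spherical x a.
Proof. by move=> m s; case; exact: dsurj0. Qed.

(** In degree 0 the condition on the boundary is void, every map to [0] being surjective. Thus pi_0
    is handled as the case n = 0 of pi_n. *)
Lemma path_relatedE (X : sSet) (x a b : X 0%N) :
  path_related a b <-> rel_homotopic x a b.
Proof.
split=> [[e [ea eb]]|[h [h1 h2]]].
  have hn m q (c : dmap m q) (s : sprod (Delta 0) (Delta 1) q) :
    sact (sact c s).2 e = sact c (sact s.2 e) by rewrite /= sact_comp.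
  exists (@SMap (sprod (Delta 0) (Delta 1)) X (fun m s => sact s.2 e) hn).
  split => [m s|m s t []]; last exact: dsurj0.
  by rewrite -ea -eb -!sact_comp; split; congr (sact _ e); apply: dmapP.
exists (h _ (dconst 1 ord0, did 1)); rewrite -!snat /=.
have e0 : Defs.dcomp (dconst 1 ord0) (dconst 0 ord0) = did 0 :> dmap 0 0.
  by apply: dmapP => i; rewrite !ord1.
have e1 i : Defs.dcomp (did 1) (dconst 0 i) = dconst 0 i by apply: dmapP.
have e2 : Defs.dcomp (dconst 1 ord0) (dconst 0 ord_max) = did 0 :> dmap 0 0.
  by apply: dmapP => i; rewrite !ord1.
rewrite e0 e2 !e1.
by have [-> ->] := h1 0%N (did 0); rewrite !sact_id.
Qed.

Lemma nsurj1 m (t : dmap m 1) : ~ dsurj t ->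
  t = dconst m ord0 \/ t = dconst m ord_max.
Proof.
move=> nt; have [/forallP t0|/forallPn[i ti]] := boolP [forall i, t i == ord0].
  by left; apply: dmapP => i; exact/eqP.
right; apply: dmapP => j; apply/val_inj => /=.
have [|tj] := eqVneq (t j) ord0; last first.
  by move: tj; case: (t j) => -[|[]].
move=> tj; case: nt => k; case: k => -[|[|//]] hk.
  by exists j; rewrite tj; apply/val_inj.
exists i; apply/val_inj; by case: (t i) ti => -[|[|//]].
Qed.

Lemma dconst01 m : dconst m ord0 <> dconst m (@ord_max 1).
Proof. by move=> e; have := congr1 (fun f : dmap m 1 => val (f ord0)) e. Qed.

(** On the boundary of the prism, the constant [x] on the sides and [a], [b] on the two ends agree
    by sphericity; the homotopy in [Y] is the map to lift. *)
Lemma trivial_fibration_homotopy (X Y : sSet) (g : smap X Y) x n (a b : X n) :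
  trivial_fibration g -> spherical x a -> spherical x b ->
  rel_homotopic (g _ x) (g _ a) (g _ b) -> rel_homotopic x a b.
Proof.
move=> tg sa sb [h [h1 h2]].
pose u m (s : prism_bd n 1 m) : X m := if `[< ~ dsurj (sval s).1 >] then Defs.cst x m
  else if `[< (sval s).2 = dconst m ord0 >] then sact (sval s).1 a
  else sact (sval s).1 b.
have u0 m (s : prism_bd n 1 m) : ~ dsurj (sval s).1 -> u m s = Defs.cst x m.
  by rewrite /u; case: asboolP.
have ua m (s : prism_bd n 1 m) : (sval s).2 = dconst m ord0 -> u m s = sact (sval s).1 a.
  by rewrite /u; case: asboolP => [/sa ->//|_]; case: asboolP.
have ub m (s : prism_bd n 1 m) : (sval s).2 = dconst m ord_max -> u m s = sact (sval s).1 b.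
  rewrite /u; case: asboolP => [/sb ->//|_]; case: asboolP => // -> /dconst01.
  by [].
have un m q (c : dmap m q) (s : prism_bd n 1 q) : u m (sact c s) = sact c (u q s).
  have [ns|s1] := pselect (~ dsurj (sval s).1).
    by rewrite u0 ?[u q s]u0 ?sact_cst // => /dsurj_compl.
  have /nsurj1[e|e] : ~ dsurj (sval s).2 by case: (svalP s).
    by rewrite ua /= ?e ?ua ?sact_comp //; apply: dmapP.
  by rewrite ub /= ?e ?ub ?sact_comp //; apply: dmapP.
have [|w [w1 w2]] := tg n 1%N (SMap un) h.
  move=> m s /=; case e : (sval s) => [s1 s2].
  have [ns|s1s] := pselect (~ dsurj (sval s).1).
    by rewrite u0 // smap_cst h2 //; rewrite e in ns.
  have /nsurj1[e'|e'] : ~ dsurj (sval s).2 by case: (svalP s).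
    rewrite ua // snat; rewrite e /= in e' *; rewrite e'.
    by have [-> _] := h1 m s1.
  rewrite ub // snat; rewrite e /= in e' *; rewrite e'.
  by have [_ ->] := h1 m s1.
have nd m i : ~ dsurj (dconst m i : dmap m 1).
  move=> si; have [j0 e0] := si ord0; have [j1 e1] := si ord_max.
  by have := congr1 val (etrans (esym e0) e1).
exists w; split => [m s|m s t ns].
- have b0 : in_bd (s, dconst m ord0 : dmap m 1) by right; exact: nd.
  have b1 : in_bd (s, dconst m ord_max : dmap m 1) by right; exact: nd.
  by rewrite (w1 m (exist _ _ b0)) (w1 m (exist _ _ b1)) /= ua // ub.
- have b0 : in_bd (s, t) by left.
  by rewrite (w1 m (exist _ _ b0)) /= u0.
Qed.

(** A lifting problem against the boundary of [Delta n], on which the map to [X] is constant at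
    [x]. *)
Lemma trivial_fibration_spherical (X Y : sSet) (g : smap X Y) x n (b : Y n) :
  trivial_fibration g -> spherical (g _ x) b ->
  exists2 a : X n, spherical x a & g _ a = b.
Proof.
move=> tg sb.
have un m q (c : dmap m q) (s : prism_bd n 0 q) : Defs.cst x m = sact c (Defs.cst x q).
  by rewrite sact_cst.
have vn m q (c : dmap m q) (s : prism n 0 q) : sact (sact c s).1 b = sact c (sact s.1 b).
  by rewrite /= sact_comp.
have bd m (s : prism n 0 m) : in_bd s -> ~ dsurj s.1.
  by case=> // -[]; exact: dsurj0.
have [|w [w1 w2]] := tg n 0%N (SMap un)
    (@SMap (prism n 0) Y (fun m (s : prism n 0 m) => sact s.1 b) vn).
  by move=> m s /=; rewrite smap_cst sb //; exact: bd (svalP s).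
exists (w n (did n, dconst n ord0)); last by rewrite w2 /= sact_id.
move=> m s ns.
have b0 : in_bd (s, dconst m ord0 : dmap m 0) by left.
have <- : w m (s, dconst m ord0) = Defs.cst x m by rewrite (w1 m (exist _ _ b0)).
rewrite -snat; congr (w m (_, _)); exact: dmapP.
Qed.

Lemma trivial_fibration_vertex (X Y : sSet) (g : smap X Y) (y : Y 0%N) :
  trivial_fibration g -> exists x, g _ x = y.
Proof.
move=> tg.
have bd m (s : prism_bd 0 0 m) : False.
  by case: s => s [] []; exact: dsurj0.
have un m q (c : dmap m q) (s : prism_bd 0 0 q) :
    (fun m s => False_rect (X m) (bd m s)) m (sact c s) =
    sact c ((fun m s => False_rect (X m) (bd m s)) q s) by case: (bd _ s).
have vn m q (c : dmap m q) (s : prism 0 0 q) : Defs.cst y m = sact c (Defs.cst y q).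
  by rewrite sact_cst.
have [|w [_ w2]] := tg 0%N 0%N (SMap un) (SMap vn).
  by move=> m s; case: (bd _ s).
exists (w _ (did 0, did 0)); rewrite w2 /= /Defs.cst -[RHS]sact_id.
by congr (sact _ y); apply: dmapP => i; rewrite !ord1.
Qed.

(** Injectivity: lift homotopies along [r], then apply [rho]. Surjectivity: lift along [r] to some
    [w]; then [i (rho w)] and [w] have the same image under the trivial fibration [rho], so they are
    homotopic, and [r] sends them to [f (rho w)] and to the given element. Homotopies are never
    composed or reversed. *)
Lemma weak_equiv_span (X W Y : sSet) (i : smap X W) (rho : smap W X)
    (r : smap W Y) (f : smap X Y) :
  (forall n x, rho n (i n x) = x) -> (forall n x, r n (i n x) = f n x) ->
  trivial_fibration rho -> trivial_fibration r -> weak_equiv f.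
Proof.
move=> rhoi ri trho tr; split.
- move=> x x' /(path_relatedE (f _ x)); rewrite -!ri => h.
  have := trivial_fibration_homotopy tr (spherical0 _ _) (spherical0 _ _) h.
  by move=> /(smap_rel_homotopic rho); rewrite !rhoi => /path_relatedE.
- move=> y; have [w <-] := trivial_fibration_vertex y tr.
  exists (rho _ w); rewrite -ri; apply/(path_relatedE (f _ (rho _ w))).
  rewrite -ri; apply: smap_rel_homotopic.
  apply: (trivial_fibration_homotopy trho); try exact: spherical0.
  by rewrite !rhoi; apply/rel_homotopic_refl/spherical0.
- move=> n x a b sa sb; rewrite -!ri => h.
  have := trivial_fibration_homotopy tr (smap_spherical i sa) (smap_spherical i sb) h.
  by move=> /(smap_rel_homotopic rho); rewrite !rhoi.
- move=> n x b; rewrite -ri => sb.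
  have [w sw <-] := trivial_fibration_spherical tr sb.
  have sa : spherical x (rho _ w) by rewrite -[x]rhoi; exact: smap_spherical.
  exists (rho _ w) => //; rewrite -!ri; apply: smap_rel_homotopic.
  apply: (trivial_fibration_homotopy trho) => //; first exact: smap_spherical.
  by rewrite !rhoi; exact: rel_homotopic_refl.
Qed.

(** * Spaces of natural families indexed by chains *)

Section Sections.
Context {d : Order.disp_t} {C : porderType d} (F : presheaf C).
Context (Z : choiceType) (ge : Z -> Z -> Prop) (rho : Z -> C).
Hypothesis rho_ge : forall x y, ge x y -> (rho y <= rho x)%O.

Record kchain (K : set (set Z)) p := KChain {
  kpt :> 'I_p.+1 -> Z;
  kpt_anti : antitone ge kpt;
  kpt_in : K (range kpt) }.

Lemma kchainP K p (x y : kchain K p) : (forall i, x i = y i) -> x = y.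
Proof.
case: x y => [x x1 x2] [y y1 y2] /= xy.
have e : x = y by apply/funext.
by subst y; congr KChain; exact: Prop_irrelevance.
Qed.

Section Complex.
Variable K : set (set Z).
Hypothesis Kd : down_closed K.

Definition kact p q (a : dmap q p) (x : kchain K p) : kchain K q :=
  KChain (antitone_comp a (kpt_anti x))
    (Kd (@range_dmap _ _ _ x a) (range_neq0 _) (kpt_in x)).

Lemma rho_kact p q (a : dmap q p) (x : kchain K p) :
  (rho (x ord_max) <= rho (x (a ord_max)))%O.
Proof. exact: (rho_antitone rho_ge (a ord_max) (kpt_anti x)). Qed.

(* The n-simplices of the space of natural families, indexed by the chains
   x_0 >= ... >= x_p with vertices in K, of p-simplices of F (rho x_p). *)
Record sect_simp n := SectSimp {
  sval_ :> forall p (x : kchain K p), dmap p n -> F (rho (x ord_max)) p;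
  snat_ : forall p q (a : dmap q p) (x : kchain K p) (s : dmap p n),
    fres F (rho_kact a x) q (sval_ (kact a x) (Defs.dcomp s a)) =
    sact a (sval_ x s) }.

Lemma sect_simpP n (u v : sect_simp n) :
  (forall p (x : kchain K p) s, u p x s = v p x s) -> u = v.
Proof.
case: u v => [u hu] [v hv] /= uv.
have e : u = v.
  by do 2 (apply: functional_extensionality_dep => ?); apply/funext => s.
by subst v; congr SectSimp; exact: Prop_irrelevance.
Qed.

Program Definition sections : sSet :=
  @SSet sect_simp (fun m n a u =>
    @SectSimp m (fun p x s => u p x (Defs.dcomp a s)) _) _ _.
Next Obligation.
move=> m n a u p q b x s /=; rewrite -snat_.
by congr (fres F _ _ (u _ _ _)); apply: dmapP.
Qed.
Next Obligation.
by move=> n u; apply: sect_simpP => p x s /=; congr (u _ _ _); apply: dmapP.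
Qed.
Next Obligation.
by move=> l m n g f u; apply: sect_simpP => p x s /=; congr (u _ _ _); apply: dmapP.
Qed.

End Complex.

Definition kincl K1 K (K1K : K1 `<=` K) p (x : kchain K1 p) : kchain K p :=
  KChain (kpt_anti x) (K1K _ (kpt_in x)).

Program Definition sect_restrict K1 K (Kd1 : down_closed K1) (Kd : down_closed K)
    (K1K : K1 `<=` K) : smap (sections Kd) (sections Kd1) :=
  @SMap (sections Kd) (sections Kd1) (fun n u =>
    @SectSimp K1 Kd1 n (fun p x s => u p (kincl K1K x) s) _) _.
Next Obligation.
move=> K1 K Kd1 Kd K1K n u p q a x s /=; rewrite -(snat_ u a (kincl K1K x) s).
have e : K1K _ (kpt_in (kact Kd1 a x)) = kpt_in (kact Kd a (kincl K1K x)) by exact: Prop_irrelevance.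
rewrite (Prop_irrelevance (rho_kact a x) (rho_kact a (kincl K1K x))).
rewrite -[kincl K1K (kact Kd1 a x)]/(KChain (kpt_anti (kact Kd1 a x)) (K1K _ (kpt_in (kact Kd1 a x)))).
by rewrite e.
Qed.
Next Obligation. by move=> *; exact: sect_simpP. Qed.

End Sections.

Lemma chain_set_range (D : choiceType) (ge : D -> D -> Prop) p (x : 'I_p.+1 -> D) :
  antitone ge x -> chain_set ge (range x).
Proof.
move=> xm; split; [exact/finite_image/finite_finset|exact: range_neq0|].
move=> _ _ [i _ <-] [j _ <-].
by have [/xm|/ltnW/xm] := leqP i j; [left|right].
Qed.

(** * Lifting problems over prisms as extension problems over chains *)

Section PrismComplex.
Variables (Z : choiceType) (ge : Z -> Z -> Prop) (a b : nat).

(** A chain of these triples is a chain of [Z] paired with a simplex of the prism of the same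
    dimension. Along it the first coordinate decreases for [ge] while the prism coordinates
    increase. *)
Definition pvertex : choiceType := (Z * ('I_a.+1 * 'I_b.+1))%type.

Definition pge (x y : pvertex) :=
  [/\ ge x.1 y.1, (x.2.1 <= y.2.1)%N & (x.2.2 <= y.2.2)%N].

Definition missed (A : set pvertex) :=
  (exists t, forall q, A q -> q.2.1 <> t) \/ (exists t, forall q, A q -> q.2.2 <> t).

Definition prism_complex (K : set (set Z)) : set (set pvertex) :=
  [set A | chain_set pge A /\ K (fst @` A)].

(** The chains on which a lifting problem prescribes the lift: those over [K1] through the map to
    the base, those in the boundary of the prism through the map to the total space. *)
Definition prism_base (K1 K : set (set Z)) : set (set pvertex) :=
  [set A | prism_complex K A /\ (K1 (fst @` A) \/ missed A)].

End PrismComplex.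

Section Lift.
Context {d : Order.disp_t} {C : porderType d} (F : presheaf C).
Context (Z : choiceType) (ge : Z -> Z -> Prop) (rho : Z -> C).
Hypothesis F_kan : space_valued F.
Hypothesis ge_refl : forall x, ge x x.
Hypothesis ge_anti : forall x y, ge x y -> ge y x -> x = y.
Hypothesis ge_trans : forall y x z, ge x y -> ge y z -> ge x z.
Hypothesis rho_ge : forall x y, ge x y -> (rho y <= rho x)%O.
Variables (K1 K : set (set Z)) (Kd1 : down_closed K1) (Kd : down_closed K).
Hypothesis K1K : K1 `<=` K.

Section Prism.
Variables a b : nat.
Let D := pvertex Z a b.
Let geD := @pge Z ge a b.
Let rhoD (x : D) := rho x.1.

Let rhoD_ge x y : geD x y -> (rhoD y <= rhoD x)%O.
Proof. by case=> /rho_ge. Qed.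

Let fst_range p (x : 'I_p.+1 -> D) : fst @` range x = range (fst \o x).
Proof. exact: image_comp. Qed.

Lemma pvertex_anti p (x : 'I_p.+1 -> D) : antitone geD x -> antitone ge (fst \o x).
Proof. by move=> xm i j /xm[]. Qed.

Definition pvertex_prism p (x : 'I_p.+1 -> D) (xm : antitone geD x) : prism a b p :=
  (@DMap p a (fun i => (x i).2.1) (fun i j ij => let: And3 _ h _ := xm i j ij in h),
   @DMap p b (fun i => (x i).2.2) (fun i j ij => let: And3 _ _ h := xm i j ij in h)).

Definition pvertex_kchain (K' : set (set Z)) p (x : 'I_p.+1 -> D)
    (xm : antitone geD x) (xK : K' (range (fst \o x))) : kchain ge K' p :=
  KChain (pvertex_anti xm) xK.

Lemma missedE p (x : 'I_p.+1 -> D) (xm : antitone geD x) :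
  missed (range x) <-> in_bd (pvertex_prism xm).
Proof.
split=> [[[t h]|[t h]]|[h|h]].
- by left => /(_ t) [j]; apply: (h (x j)); exists j.
- by right => /(_ t) [j]; apply: (h (x j)); exists j.
- left; apply: contrapT => h'; apply: h => t; apply: contrapT => ht; apply: h'.
  by exists t => _ [j _ <-] e; apply: ht; exists j.
- right; apply: contrapT => h'; apply: h => t; apply: contrapT => ht; apply: h'.
  by exists t => _ [j _ <-] e; apply: ht; exists j.
Qed.

Lemma pvertex_prism_act p q (c : dmap q p) (x : 'I_p.+1 -> D) (xm : antitone geD x)
    (xcm : antitone geD (fun i => x (c i))) :
  pvertex_prism xcm = sact c (pvertex_prism xm).
Proof. by congr (_, _); apply: dmapP. Qed.

Variables (u : smap (prism_bd a b) (sections F rho_ge Kd))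
  (v : smap (prism a b) (sections F rho_ge Kd1)).
Hypothesis uv : forall m s, sect_restrict F rho_ge Kd1 Kd K1K m (u m s) = v m (sval s).

(** Evaluation at the identity simplex [did p] determines a map from the prism to the sections, as
    in the Yoneda lemma. Where both clauses apply they agree, since the square commutes. *)
Definition lift_base : prel F rhoD := fun p x y =>
  (exists (xm : antitone geD x) (xK : K1 (range (fst \o x))),
     y = v p (pvertex_prism xm) p (pvertex_kchain xm xK) (did p)) \/
  (exists (xm : antitone geD x) (xK : K (range (fst \o x))) s,
     sval s = pvertex_prism xm /\ y = u p s p (pvertex_kchain xm xK) (did p)).

Lemma lift_base_fun p (x : 'I_p.+1 -> D) y y' :
  lift_base y -> lift_base (x := x) y' -> y = y'.
Proof.
have vK (xm xm' : antitone geD x) (xK xK' : K1 (range (fst \o x))) :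
    v p (pvertex_prism xm) p (pvertex_kchain xm xK) (did p) =
    v p (pvertex_prism xm') p (pvertex_kchain xm' xK') (did p).
  by rewrite (Prop_irrelevance xm xm') (Prop_irrelevance xK xK').
have uK (xm xm' : antitone geD x) (xK xK' : K (range (fst \o x))) s s' :
    sval s = pvertex_prism xm -> sval s' = pvertex_prism xm' ->
    u p s p (pvertex_kchain xm xK) (did p) =
    u p s' p (pvertex_kchain xm' xK') (did p).
  rewrite (Prop_irrelevance xm xm') (Prop_irrelevance xK xK') => e e'.
  have -> // : s = s'.
  by apply: eq_sig_hprop => [*|]; [exact: Prop_irrelevance|rewrite e].
have uvK (xm xm' : antitone geD x) (xK : K1 (range (fst \o x)))
    (xK' : K (range (fst \o x))) s : sval s = pvertex_prism xm' ->
    v p (pvertex_prism xm) p (pvertex_kchain xm xK) (did p) =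
    u p s p (pvertex_kchain xm' xK') (did p).
  rewrite (Prop_irrelevance xm xm') => <-; rewrite -uv /=.
  rewrite -[kincl _ _]/(pvertex_kchain xm' (K1K xK)).
  by rewrite (Prop_irrelevance (K1K xK) xK').
move=> [[xm [xK ->]]|[xm [xK [s [e ->]]]]] [[xm' [xK' ->]]|[xm' [xK' [s' [e' ->]]]]].
- exact: vK.
- exact: uvK.
- by apply/esym/uvK.
- exact: uK.
Qed.

Lemma lift_base_nat p q (x : 'I_p.+1 -> D) (c : dmap q p) y
    (h : (rhoD (x ord_max) <= rhoD (x (c ord_max)))%O) : lift_base y ->
  exists2 w, lift_base (x := fun i => x (c i)) w & fres F h q w = sact c y.
Proof.
have e : Defs.dcomp c (did q) = Defs.dcomp (did p) c by apply: dmapP.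
move=> [[xm [xK ->]]|[xm [xK [s [es ->]]]]]; have xcm := antitone_comp c xm.
- have xcK : K1 (range (fst \o (fun i => x (c i)))).
    exact: Kd1 (@range_dmap _ _ _ (fst \o x) c) (range_neq0 _) xK.
  exists (v q (pvertex_prism xcm) q (pvertex_kchain xcm xcK) (did q)).
    by left; exists xcm, xcK.
  rewrite -snat_ (pvertex_prism_act xm xcm) snat /= e.
  rewrite (Prop_irrelevance h (rho_kact rho_ge c (pvertex_kchain xm xK))).
  rewrite -[pvertex_kchain xcm xcK]/(KChain (pvertex_anti xcm) xcK).
  by rewrite (Prop_irrelevance (pvertex_anti xcm) (antitone_comp c (pvertex_anti xm)))
    (Prop_irrelevance xcK (Kd1 (@range_dmap _ _ _ _ c) (range_neq0 _) xK)).
- have xcK : K (range (fst \o (fun i => x (c i)))).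
    exact: Kd (@range_dmap _ _ _ (fst \o x) c) (range_neq0 _) xK.
  pose cs := @sact (prism_bd a b) _ _ c s.
  exists (u q cs q (pvertex_kchain xcm xcK) (did q)).
    right; exists xcm, xcK, cs; split => //=.
    by rewrite es (pvertex_prism_act xm xcm).
  rewrite -snat_ /cs snat /= e.
  rewrite (Prop_irrelevance h (rho_kact rho_ge c (pvertex_kchain xm xK))).
  rewrite -[pvertex_kchain xcm xcK]/(KChain (pvertex_anti xcm) xcK).
  by rewrite (Prop_irrelevance (pvertex_anti xcm) (antitone_comp c (pvertex_anti xm)))
    (Prop_irrelevance xcK (Kd (@range_dmap _ _ _ _ c) (range_neq0 _) xK)).
Qed.

Lemma lift_base_psection : psection geD (prism_base ge (a := a) (b := b) K1 K) lift_base.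
Proof.
split.
- move=> p x y [[xm [xK _]]|[xm [xK [s [es _]]]]]; split => //; split.
  + by split; [exact: chain_set_range|rewrite fst_range; exact: K1K].
  + by left; rewrite fst_range.
  + by split; [exact: chain_set_range|rewrite fst_range].
  + by right; apply/(missedE xm); rewrite -es; exact: svalP s.
- move=> p x xm [[_ xK]]; rewrite fst_range in xK *; case=> [xK1|/(missedE xm) xb].
    by exists (v p (pvertex_prism xm) p (pvertex_kchain xm xK1) (did p)); left; exists xm, xK1.
  exists (u p (exist _ _ xb) p (pvertex_kchain xm xK) (did p)).
  by right; exists xm, xK, (exist _ _ xb).
- by move=> p x y y'; exact: lift_base_fun.
- move=> p q x c y w h hy hw; have [w' hw' <-] := lift_base_nat h hy.
  by rewrite (lift_base_fun hw hw').
Qed.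

Variables (pv : set D -> D) (mu1 mu2 : set D -> nat).
Hypothesis col : collapse geD rhoD (prism_base ge (a := a) (b := b) K1 K)
  (prism_complex ge (a := a) (b := b) K) pv mu1 mu2.

Lemma prism_lift : exists w : smap (prism a b) (sections F rho_ge Kd),
  (forall m s, w m (sval s) = u m s) /\
  (forall m s, sect_restrict F rho_ge Kd1 Kd K1K m (w m s) = v m s).
Proof.
have geD_refl x : geD x x by split.
have geD_anti x y : geD x y -> geD y x -> x = y.
  case: x y => [x [x1 x2]] [y [y1 y2]] [/= xy xy1 xy2] [/= yx yx1 yx2].
  by congr (_, (_, _)); [exact: ge_anti|apply/val_inj/anti_leq/andP..].
have geD_trans y x z : geD x y -> geD y z -> geD x z.
  by move=> [xy xy1 xy2] [yz yz1 yz2]; split; [exact: ge_trans yz|exact: leq_trans yz1|exact: leq_trans yz2].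
have [R Rs sub] := psection_extend F_kan geD_refl geD_anti geD_trans rhoD_ge col lift_base_psection.
(* The lift at [s], evaluated on a chain [x] and a simplex [t], is the value of the extension on the
   chain that pairs [x] with [sact t s]. *)
pose pt p (x : kchain ge K p) (s : prism a b p) : 'I_p.+1 -> D :=
  fun i => (x i, (s.1 i, s.2 i)).
have ptm p (x : kchain ge K p) s : antitone geD (pt p x s).
  by move=> i j ij; split; [exact: kpt_anti|exact: dmono..].
have ptK p (x : kchain ge K p) s : prism_complex ge K (range (pt p x s)).
  split; first exact/chain_set_range/ptm.
  by rewrite fst_range; exact: (kpt_in x).
have ex p (x : kchain ge K p) s := cid (ps_ex Rs (ptm p x s) (ptK p x s)).
have wn m (s : prism a b m) p q (c : dmap q p) (x : kchain ge K p) (t : dmap p m) :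
    fres F (rho_kact rho_ge c x) q (sval (ex q (kact Kd c x) (sact (Defs.dcomp t c) s))) =
    sact c (sval (ex p x (sact t s))).
  pose y := ex q (kact Kd c x) (sact (Defs.dcomp t c) s).
  have Ry : R q (fun i => pt p x (sact t s) (c i)) (sval y) := svalP y.
  have h : (rhoD (pt p x (sact t s) ord_max) <= rhoD (pt p x (sact t s) (c ord_max)))%O.
    exact: (rho_kact rho_ge c x).
  rewrite (Prop_irrelevance (rho_kact rho_ge c x) h).
  exact: (ps_nat Rs h (svalP (ex p x (sact t s))) Ry).
pose w0 m (s : prism a b m) : sections F rho_ge Kd m :=
  SectSimp (Kd := Kd) (wn m s).
have w0n m n (c : dmap m n) (s : prism a b n) : w0 m (sact c s) = sact c (w0 n s).
  apply: sect_simpP => p x t /=.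
  exact: (ps_fun Rs (svalP (ex p x _)) (svalP (ex p x _))).
exists (SMap w0n); split => [m s|m s] /=; apply: sect_simpP => p [x xa xK] t /=.
- pose sq := @sact (prism a b) _ _ t (sval s).
  apply: (ps_fun Rs (svalP (ex p (KChain xa xK) sq))); apply: sub; right.
  exists (ptm p (KChain xa xK) sq), xK, (@sact (prism_bd a b) _ _ t s); split.
    by congr (_, _); apply: dmapP.
  rewrite snat /=.
  have -> : Defs.dcomp t (did p) = t by apply: dmapP.
  rewrite /pvertex_kchain.
  by rewrite (Prop_irrelevance (pvertex_anti (ptm p (KChain xa xK) sq))
    (xa : antitone ge (fst \o pt p (KChain xa xK) sq))).
- set y := kincl K1K (KChain xa xK); pose sq := @sact (prism a b) _ _ t s.
  apply: (ps_fun Rs (svalP (ex p y sq))); apply: sub; left.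
  exists (ptm p y sq), xK.
  have -> : pvertex_prism (ptm p y sq) = sq by congr (_, _); apply: dmapP.
  rewrite snat /=.
  have -> : Defs.dcomp t (did p) = t by apply: dmapP.
  rewrite /pvertex_kchain.
  by rewrite (Prop_irrelevance (pvertex_anti (ptm p y sq))
    (xa : antitone ge (fst \o pt p y sq))).
Qed.

End Prism.

Theorem sect_restrict_trivial_fibration :
  (forall a b, exists pv mu1 mu2, collapse (@pge Z ge a b) (fun x => rho x.1)
     (prism_base ge K1 K) (prism_complex ge K) pv mu1 mu2) ->
  trivial_fibration (sect_restrict F rho_ge Kd1 Kd K1K).
Proof.
move=> col a b u v uv; have [pv [mu1 [mu2 cab]]] := col a b.
exact: prism_lift cab.
Qed.

End Lift.

(** * The mapping cylinder *)

Lemma trivial_fibration_iso (X Y Y' : sSet) (g : smap X Y) (e : smap Y Y')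
    (e' : smap Y' Y) :
  (forall n y, e' n (e n y) = y) -> (forall n y, e n (e' n y) = y) ->
  trivial_fibration g -> trivial_fibration (scompose e g).
Proof.
move=> ee' e'e tg a b u v uv.
have [|w [w1 w2]] := tg a b u (scompose e' v).
  by move=> m s; rewrite /= -uv ee'.
by exists w; split => // m s /=; rewrite w2 /= e'e.
Qed.

Lemma hval_congr d (T : porderType d) (G : presheaf T) S n (u : holim_simp S G n)
    c p (Sc Sc' : S c) (x x' : chain S c p) (s s' : dmap p n) :
  (forall i, x i = x' i) -> (forall i, s i = s' i) ->
  u c Sc p (x, s) = u c Sc' p (x', s').
Proof.
by move=> /chainP xx /dmapP ss; subst x' s'; rewrite (Prop_irrelevance Sc Sc').
Qed.

Section CofinalMaps.
Context {dC dJ : Order.disp_t} {C : porderType dC} {J : porderType dJ}.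
Context (F : presheaf C) (S : set C) (JS : set J) (O : J -> set C).
Hypothesis O_mono : forall j j' : J, (j <= j')%O -> O j `<=` O j'.
Hypothesis O_sub : forall j, JS j -> O j `<=` S.

Definition cyl : choiceType := (option J * C)%type.

Definition cyl_pt (z : cyl) : C := z.2.

(* The mapping cylinder of the projection to C: every (Some j, c) is above
   (None, c). *)
Definition cyl_ge (x y : cyl) := (y.2 <= x.2)%O /\
  match x.1, y.1 with
  | Some j, Some j' => (j' <= j)%O
  | None, Some _ => False
  | _, None => True
  end.

Lemma cyl_ge_pt x y : cyl_ge x y -> (cyl_pt y <= cyl_pt x)%O.
Proof. by case. Qed.

Lemma cyl_ge_refl x : cyl_ge x x.
Proof. by case: x => [[j|] c]; split => /=. Qed.

Lemma cyl_ge_anti x y : cyl_ge x y -> cyl_ge y x -> x = y.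
Proof.
case: x y => [[j|] c] [[j'|] c'] [/= h1 h2] [/= h3 h4] //; congr (_, _).
- by congr Some; apply: le_anti; rewrite h4.
- by apply: le_anti; rewrite h3.
- by apply: le_anti; rewrite h3.
Qed.

Lemma cyl_ge_trans y x z : cyl_ge x y -> cyl_ge y z -> cyl_ge x z.
Proof.
case: x y z => [[j|] c] [[j'|] c'] [[j''|] c''] [/= h1 h2] [/= h3 h4] //;
  split => //=; by [exact: le_trans h1|exact: le_trans h2].
Qed.

(* The pairs in a chain of KW are required to have all their second components
   in all the O j, and not only c in O j for each pair (j, c): the families
   indexed by KY then make up the iterated homotopy limit exactly. *)
Definition KW : set (set cyl) := [set A | (forall z, A z -> S z.2) /\
  forall j j' c c', A (Some j, c) -> A (Some j', c') -> JS j /\ O j c'].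
Definition KX : set (set cyl) := [set A | KW A /\ forall z, A z -> z.1 = None].
Definition KY : set (set cyl) := [set A | KW A /\ forall z, A z -> z.1 <> None].

Lemma KW_down : down_closed KW.
Proof.
move=> A B AB _ [B1 B2]; split => [z /AB /B1//|j j' c c' /AB h /AB].
exact: B2 h.
Qed.

Lemma KX_down : down_closed KX.
Proof.
move=> A B AB A0 [KB B1]; split; first exact: KW_down KB.
by move=> z /AB /B1.
Qed.

Lemma KY_down : down_closed KY.
Proof.
move=> A B AB A0 [KB B1]; split; first exact: KW_down KB.
by move=> z /AB /B1.
Qed.

Lemma KX_sub : KX `<=` KW. Proof. by move=> A []. Qed.
Lemma KY_sub : KY `<=` KW. Proof. by move=> A []. Qed.

Notation Sections Kd := (sections F cyl_ge_pt Kd).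
Let sX := Sections KX_down.
Let sY := Sections KY_down.
Let sW := Sections KW_down.
Let X := holim S F.
Let Y := holim JS (holim_presheaf O_mono F).

Lemma sect_congr K (Kd : down_closed K) n (u : Sections Kd n) p
    (x y : kchain cyl_ge K p) (s t : dmap p n)
    (h : (cyl_pt (x ord_max) <= cyl_pt (y ord_max))%O) :
  (forall i, x i = y i) -> (forall i, s i = t i) ->
  fres F h p (u p y t) = u p x s.
Proof. by move=> /kchainP xy /dmapP st; subst y t; rewrite fres_id. Qed.

Lemma sect_congr2 K (Kd : down_closed K) n (u : Sections Kd n) p c
    (x y : kchain cyl_ge K p) (s t : dmap p n)
    (h : (c <= cyl_pt (x ord_max))%O) (h' : (c <= cyl_pt (y ord_max))%O) :
  (forall i, x i = y i) -> (forall i, s i = t i) ->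
  fres F h p (u p x s) = fres F h' p (u p y t).
Proof.
by move=> /kchainP xy /dmapP st; subst y t; rewrite (Prop_irrelevance h h').
Qed.

(** * The homotopy limit over S as a space of sections *)

Definition kchain_chain p (x : kchain cyl_ge KW p) : chain S (cyl_pt (x ord_max)) p.
Proof.
exists (fun i => (x i).2).
- by move=> i; have [h _] := kpt_in x; apply: h; exists i.
- by move=> i; have [] := kpt_anti x (leq_ord i : (i <= @ord_max p)%N).
- by move=> i j /(kpt_anti x)[].
Defined.

Lemma kchain_S p (x : kchain cyl_ge KW p) i : S (cyl_pt (x i)).
Proof. by have [h _] := kpt_in x; apply: h; exists i. Qed.

Program Definition cyl_pull : smap X sW :=
  @SMap X sW (fun n u => @SectSimp _ _ F _ _ _ cyl_ge_pt _ KW_down n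
    (fun p x s => hval u (kchain_S x ord_max) p (kchain_chain x, s)) _) _.
Next Obligation.
move=> n u p q a x s.
rewrite -(hnat u (kchain_S (kact KW_down a x) ord_max) (kchain_S x ord_max)).
rewrite -(snat (u _ _)) /=.
exact: hval_congr.
Qed.
Next Obligation. by move=> m n a u; apply: sect_simpP. Qed.

Definition chain_kchain c p (x : chain S c p) : kchain cyl_ge KX p.
Proof.
exists (fun i => (None, x i)).
- by move=> i j ij; split => //=; exact: cpt_anti.
- split; last by move=> _ [i _ <-].
  by split=> [_ [i _ <-]|j j' c1 c2 [i _ []]]; [exact: cpt_in|].
Defined.

(** Inverse to evaluation over the last vertex: by naturality, the value of a family over [c] on a
    chain is the restriction of its value over the last vertex of that chain. *)
Program Definition sect_holim : smap sX X :=
  @SMap sX X (fun n u => @HolimSimp _ _ S F n (fun c Sc =>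
    @SMap (sprod (nerve_over S c) (Delta n)) (F c)
      (fun p z => fres F (cpt_ge z.1 ord_max : (c <= cyl_pt (chain_kchain z.1 ord_max))%O) p
         (sval_ u (chain_kchain z.1) z.2)) _) _) _.
Next Obligation.
move=> n u c Sc p q a [x s] /=.
rewrite -(snat (fres F _)) -(snat_ u a (chain_kchain x) s).
have h : (c <= cyl_pt (kact KX_down a (chain_kchain x) ord_max))%O := cpt_ge x (a ord_max).
rewrite (fres_comp _ _ h); exact: sect_congr2.
Qed.
Next Obligation.
move=> n u c c' Sc Sc' h p x s /=.
have h' : (c' <= cyl_pt (chain_kchain x ord_max))%O := le_trans h (cpt_ge x ord_max).
by rewrite (fres_comp _ _ h'); exact: sect_congr2.
Qed.
Next Obligation. by move=> m n a u; apply: holim_simpP => c Sc p x s; apply: sect_congr2. Qed.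

Let restrX := sect_restrict F cyl_ge_pt KX_down KW_down KX_sub.
Let restrY := sect_restrict F cyl_ge_pt KY_down KW_down KY_sub.

Lemma sect_holimK n (u : X n) : sect_holim n (restrX n (cyl_pull n u)) = u.
Proof.
apply: holim_simpP => c Sc p x s /=.
by rewrite -(hnat u _ Sc) /=; apply: hval_congr.
Qed.

Lemma holim_sectK n (u : sX n) : restrX n (cyl_pull n (sect_holim n u)) = u.
Proof.
apply: sect_simpP => p x s /=; apply: sect_congr => // i.
have [_ h] := kpt_in x; have : (x i).1 = None by apply: h; exists i.
by rewrite /=; case: (x i) => o c /= ->.
Qed.

(** * The iterated homotopy limit as a space of sections *)

Definition some_of (o : option J) : o <> None -> J :=
  if o is Some j then fun=> j else fun h => False_rect J (h erefl).

Lemma some_ofE o (h : o <> None) : Some (some_of h) = o.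
Proof. by case: o h. Qed.

Section KYChain.
Variables (p : nat) (x : kchain cyl_ge KY p).

Lemma ky_neq i : (x i).1 <> None.
Proof. by have [_ h] := kpt_in x; apply: h; exists i. Qed.

Definition ky_idx i := some_of (@ky_neq i).

Lemma kyE i : x i = (Some (ky_idx i), (x i).2).
Proof. by rewrite some_ofE -surjective_pairing. Qed.

Lemma ky_adm i j : JS (ky_idx i) /\ O (ky_idx i) (x j).2.
Proof.
have [[_ h] _] := kpt_in x; apply: (h _ (ky_idx j) (x i).2).
  by rewrite -kyE; exists i.
by rewrite -kyE; exists j.
Qed.

Definition ky_chainJ q (a : dmap q p) j (h : (j <= ky_idx (a ord_max))%O) :
  chain JS j q.
Proof.
exists (fun i => ky_idx (a i)).
- by move=> i; have [] := ky_adm (a i) (a i).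
- move=> i; apply: le_trans h _.
  have [_] := kpt_anti x (dmono a (leq_ord i : (i <= @ord_max q)%N)).
  by rewrite -(some_ofE (@ky_neq (a i))) -(some_ofE (@ky_neq (a ord_max))).
- move=> i i' /(dmono a) /(kpt_anti x) [_].
  by rewrite -(some_ofE (@ky_neq (a i))) -(some_ofE (@ky_neq (a i'))).
Defined.

Definition ky_chainC q (a : dmap q p) j c (h : (c <= (x (a ord_max)).2)%O)
  (hO : forall i, O j (x (a i)).2) : chain (O j) c q.
Proof.
exists (fun i => (x (a i)).2) => //.
- move=> i; apply: le_trans h _.
  by have [] := kpt_anti x (dmono a (leq_ord i : (i <= @ord_max q)%N)).
- by move=> i i' /(dmono a) /(kpt_anti x) [].
Defined.

End KYChain.

Arguments ky_chainJ [p x q] a [j].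
Arguments ky_chainC [p x q] a [j c].

Definition ky_JS p (x : kchain cyl_ge KY p) i := (ky_adm x i i).1.
Definition ky_O p (x : kchain cyl_ge KY p) i j := (ky_adm x i j).2.

Definition iter_val n (u : Y n) j (Sj : JS j) p (y : chain JS j p) (s : dmap p n)
    c (Oc : O j c) q (z : chain (O j) c q) (t : dmap q p) : F c q :=
  hval (hval u Sj p (y, s) : holim_simp (O j) F p) Oc q (z, t).

Lemma iter_val_congr n (u : Y n) j (Sj Sj' : JS j) p (y y' : chain JS j p) (s s' : dmap p n)
    c (Oc Oc' : O j c) q (z z' : chain (O j) c q) (t t' : dmap q p) :
  (forall i, y i = y' i) -> (forall i, s i = s' i) ->
  (forall i, z i = z' i) -> (forall i, t i = t' i) ->
  iter_val u Sj y s Oc z t = iter_val u Sj' y' s' Oc' z' t'.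
Proof.
move=> /chainP yy /dmapP ss /chainP zz /dmapP tt; subst y' s' z' t'.
by rewrite (Prop_irrelevance Sj Sj') (Prop_irrelevance Oc Oc').
Qed.

(** The outer values are simplicial in (y, s), so the outer chain may be pulled back along [t].
    Hence the diagonal values, with equal dimensions and [t] the identity, determine all the others,
    and one chain of pairs encodes the two limits. *)
Lemma iter_val_act n (u : Y n) j (Sj : JS j) p (y : chain JS j p) (s : dmap p n)
    c (Oc : O j c) q (z : chain (O j) c q) (t : dmap q p) :
  iter_val u Sj y s Oc z t =
  iter_val u Sj (chain_act t y) (Defs.dcomp s t) Oc z (did q).
Proof.
rewrite /iter_val -[(chain_act t y, Defs.dcomp s t)]/(sact t ((y, s) : sprod (nerve_over JS j) (Delta n) p)).
by rewrite snat /=; apply: hval_congr.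
Qed.

Lemma iter_val_snat n (u : Y n) j (Sj : JS j) p (y : chain JS j p) (s : dmap p n)
    c (Oc : O j c) q (z : chain (O j) c q) (t : dmap q p) r (a : dmap r q) :
  sact a (iter_val u Sj y s Oc z t) =
  iter_val u Sj y s Oc (chain_act a z) (Defs.dcomp t a).
Proof. by rewrite /iter_val -snat. Qed.

Lemma iter_val_C n (u : Y n) j (Sj : JS j) p (y : chain JS j p) (s : dmap p n)
    c (Oc : O j c) c' (Oc' : O j c') (h : (c' <= c)%O) q (z : chain (O j) c q)
    (z' : chain (O j) c' q) (t : dmap q p) :
  (forall i, z i = z' i) ->
  fres F h q (iter_val u Sj y s Oc z t) = iter_val u Sj y s Oc' z' t.
Proof.
by move=> zz; rewrite /iter_val -(hnat _ _ Oc'); apply: hval_congr.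
Qed.

Lemma iter_val_J n (u : Y n) j (Sj : JS j) j' (Sj' : JS j') (h : (j' <= j)%O)
    p (y : chain JS j p) (y' : chain JS j' p) (s : dmap p n)
    c (Oc : O j c) (Oc' : O j' c) q (z : chain (O j) c q)
    (z' : chain (O j') c q) (t : dmap q p) :
  (forall i, y i = y' i) -> (forall i, z i = z' i) ->
  iter_val u Sj y s Oc z t = iter_val u Sj' y' s Oc' z' t.
Proof.
move=> yy zz; rewrite /iter_val.
have -> : y' = chain_map (@subset_refl _ JS) h y by apply: chainP => i; rewrite -yy.
by rewrite (hnat u Sj Sj' h) /=; apply: hval_congr.
Qed.

Program Definition holim_sectY : smap Y sY :=
  @SMap Y sY (fun n u => @SectSimp _ _ F _ _ _ cyl_ge_pt _ KY_down n
    (fun p x s => iter_val u (ky_JS x ord_max) (ky_chainJ (did p) (lexx _)) s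
       (ky_O x ord_max ord_max) (ky_chainC (did p) (lexx _) (ky_O x ord_max)) (did p)) _) _.
Next Obligation.
move=> n u p q a x s /=.
set x' := kact KY_down a x.
have hj : (ky_idx x ord_max <= ky_idx x (a ord_max))%O.
  have [_] := kpt_anti x (leq_ord (a ord_max) : (a ord_max <= @ord_max p)%N).
  by rewrite (kyE x ord_max) (kyE x (a ord_max)).
have idxE i : ky_idx x' i = ky_idx x (a i).
  by apply: Some_inj; rewrite !some_ofE.
have hj' : (ky_idx x ord_max <= ky_idx x' ord_max)%O by rewrite idxE.
have Oc' : O (ky_idx x' ord_max) (x ord_max).2 by rewrite idxE; exact: ky_O.
have hc : ((x ord_max).2 <= (x (a ord_max)).2)%O := rho_kact cyl_ge_pt a x.
have hO i : O (ky_idx x' ord_max) (x (a i)).2 by rewrite idxE; exact: ky_O.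
rewrite (@iter_val_C n u _ _ _ _ _ _ _ _ Oc' _ _ _ (ky_chainC a hc hO)) //.
rewrite iter_val_snat iter_val_act.
(* Lowering the index to that of the last pair requires the open sets of the face to be in [O] of
   this lower index: this is where the condition across pairs in [KW] enters. *)
rewrite (@iter_val_J n u _ _ _ (ky_JS x ord_max) hj' _ _ (ky_chainJ a hj) _ _ _
  (ky_O x ord_max ord_max) _ _ (ky_chainC a hc (fun i => ky_O x ord_max (a i)))) //.
rewrite [RHS]iter_val_act; exact: iter_val_congr.
Qed.
Next Obligation.
by move=> m n a u; apply: sect_simpP => p x s /=; rewrite /iter_val.
Qed.

(** Admissible because [j] is below every index of [y]: the members of [O j] are in the [O] of each
    of these indices. *)
Definition chains_kchain j p (y : chain JS j p) c q (z : chain (O j) c q)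
  (t : dmap q p) : kchain cyl_ge KY q.
Proof.
exists (fun i => (Some (y (t i)), z i)).
- by move=> i i' ii; split => /=; [exact: cpt_anti|exact/cpt_anti/dmono].
- split; last by move=> _ [i _ <-].
  split=> [_ [i _ <-] /=|j1 j2 c1 c2 [i _ [<- _]] [i' _ [_ <-]]].
    apply: (O_sub (cpt_in y (t i))); apply: (O_mono (cpt_ge y (t i))).
    exact: cpt_in.
  split; first exact: cpt_in.
  exact: O_mono (cpt_ge y (t i)) _ (cpt_in z i').
Defined.

Definition sect_iter_val n (u : sY n) j p (y : chain JS j p) (s : dmap p n)
    c q (z : chain (O j) c q) (t : dmap q p) : F c q :=
  fres F (cpt_ge z ord_max : (c <= cyl_pt (chains_kchain y z t ord_max))%O) q
    (sval_ u (chains_kchain y z t) (Defs.dcomp s t)).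

Program Definition sect_iter_inner n (u : sY n) j p (y : chain JS j p)
    (s : dmap p n) : holim_simp (O j) F p :=
  @HolimSimp _ _ (O j) F p (fun c Oc =>
    @SMap (sprod (nerve_over (O j) c) (Delta p)) (F c)
      (fun q z => sect_iter_val u y s z.1 z.2) _) _.
Next Obligation.
move=> n u j p y s c Oc q r a [z t] /=; rewrite /sect_iter_val.
rewrite -(snat (fres F _)) -(snat_ u a (chains_kchain y z t) (Defs.dcomp s t)).
have h : (c <= cyl_pt (kact KY_down a (chains_kchain y z t) ord_max))%O := cpt_ge z (a ord_max).
by rewrite (fres_comp _ _ h); exact: sect_congr2.
Qed.
Next Obligation.
move=> n u j p y s c c' Oc Oc' h q z t /=; rewrite /sect_iter_val.
have h' : (c' <= cyl_pt (chains_kchain y z t ord_max))%O := le_trans h (cpt_ge z ord_max).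
by rewrite (fres_comp _ _ h'); exact: sect_congr2.
Qed.

Program Definition sectY_holim : smap sY Y :=
  @SMap sY Y (fun n u => @HolimSimp _ _ JS (holim_presheaf O_mono F) n (fun j Sj =>
    @SMap (sprod (nerve_over JS j) (Delta n)) (holim_presheaf O_mono F j)
      (fun p z => sect_iter_inner u z.1 z.2) _) _) _.
Next Obligation.
move=> n u j Sj p q a [y s]; apply: holim_simpP => c Oc r z t /=.
by rewrite /sect_iter_val; exact: sect_congr2.
Qed.
Next Obligation.
move=> n u j j' Sj Sj' h p y s; apply: holim_simpP => c Oc r z t /=.
by rewrite /sect_iter_val; exact: sect_congr2.
Qed.
Next Obligation.
move=> m n a u; apply: holim_simpP => j Sj p y s; apply: holim_simpP => c Oc q z t.
by rewrite /= /sect_iter_val; apply: (@sect_congr2 _ KY_down _ u).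
Qed.

Lemma sectY_holimK n (u : sY n) : holim_sectY n (sectY_holim n u) = u.
Proof.
apply: sect_simpP => p x s; rewrite /= /iter_val /= /sect_iter_val.
by apply: sect_congr => // i; rewrite [LHS]kyE.
Qed.

Lemma holim_sectYK n (u : Y n) : sectY_holim n (holim_sectY n u) = u.
Proof.
apply: holim_simpP => j Sj p y s; apply: holim_simpP => c Oc q z t /=.
rewrite /sect_iter_val /=.
set x := chains_kchain y z t.
have idxE i : ky_idx x i = y (t i) by apply: Some_inj; rewrite some_ofE.
have h : (j <= ky_idx x ord_max)%O by rewrite idxE; exact: cpt_ge.
have hO i : O (ky_idx x ord_max) (x i).2.
  by rewrite idxE; apply: O_mono (cpt_ge y (t ord_max)) _ (cpt_in z i).
have Oc' : O (ky_idx x ord_max) c.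
  by rewrite idxE; exact: O_mono (cpt_ge y (t ord_max)) _ Oc.
have hc : (c <= (x (did q ord_max)).2)%O := cpt_ge z ord_max.
rewrite (@iter_val_C n u _ _ _ _ _ _ _ _ Oc' _ _ _ (ky_chainC (did q) hc hO)) //.
rewrite (@iter_val_J n u _ _ _ Sj h _ _ (chain_act t y) _ _ _ Oc _ _ z) //.
by rewrite -[RHS]/(iter_val u Sj y s Oc z t) [RHS]iter_val_act.
Qed.

Theorem cofinal_weak_equiv
  (fc : forall (j j' : J) (Sj : JS j) (Sj' : JS j') (h : (j' <= j)%O) n (x : X n),
    holim_sub F (O_sub Sj') n x =
    fres (holim_presheaf O_mono F) h n (holim_sub F (O_sub Sj) n x)) :
  trivial_fibration restrX -> trivial_fibration restrY ->
  weak_equiv (@holim_cone _ _ JS (holim_presheaf O_mono F) X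
    (fun j Sj => holim_sub F (O_sub Sj)) fc).
Proof.
move=> tX tY.
apply: (@weak_equiv_span X sW Y cyl_pull (scompose sect_holim restrX)
  (scompose sectY_holim restrY)).
- exact: sect_holimK.
- move=> n u; apply: holim_simpP => j Sj p y s; apply: holim_simpP => c Oc q z t /=.
  rewrite /sect_iter_val /= -(hnat u _ (O_sub Sj Oc)) /=; exact: hval_congr.
- apply: (trivial_fibration_iso (e' := scompose restrX cyl_pull)) tX.
  + by move=> n u; exact: holim_sectK.
  + by move=> n u; exact: sect_holimK.
- apply: (trivial_fibration_iso (e' := holim_sectY)) tY.
  + exact: sectY_holimK.
  + exact: holim_sectYK.
Qed.

End CofinalMaps.

(** * Matchings *)

Section FiniteSums.
Variable (D : choiceType).
Implicit Types (A : set D) (w : D -> nat).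

Definition wsum w A := \big[addn/0%N]_(q \in A) w q.

Lemma wsumD1 w A v : finite_set A -> A v -> wsum w A = (w v + wsum w (A `\ v))%N.
Proof. by move=> Af Av; rewrite /wsum (fsbigD1 v). Qed.

Lemma setU1_id A v : A v -> v |` A = A.
Proof. by move=> Av; rewrite eqEsubset; split => x; [case=> [->|]|right]. Qed.

Lemma wsumU1 w A v : finite_set A -> ~ A v -> wsum w (v |` A) = (w v + wsum w A)%N.
Proof.
move=> Af Av; rewrite (@wsumD1 w _ v) ?finite_setU //; last by left.
congr (_ + wsum w _)%N; rewrite eqEsubset; split => [x [[->|//] []//]|x Ax].
by split; [right|move=> /= xv; rewrite -xv in Av].
Qed.

Lemma leq_wsumU1 w A v : finite_set A -> (wsum w (v |` A) <= w v + wsum w A)%N.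
Proof.
move=> Af; have [Av|Av] := pselect (A v); last by rewrite wsumU1.
by rewrite setU1_id // leq_addl.
Qed.

End FiniteSums.

Section Chains.
Context (D : choiceType) (ge : D -> D -> Prop).
Hypothesis ge_trans : forall y x z, ge x y -> ge y z -> ge x z.
Hypothesis ge_refl : forall x, ge x x.

Lemma chain_set_sub A B : A `<=` B -> A !=set0 -> chain_set ge B -> chain_set ge A.
Proof.
move=> AB A0 [Bf _ Bt]; split => //; first exact: sub_finite_set Bf.
by move=> x y /AB Bx /AB By; exact: Bt.
Qed.

Lemma chain_setU1 A v : chain_set ge A -> (forall q, A q -> ge v q \/ ge q v) ->
  chain_set ge (v |` A).
Proof.
move=> [Af A0 At] Av; split; [by rewrite finite_setU|by exists v; left|].
move=> x y [->|Ax] [->|Ay]; [by left|exact: Av| |exact: At].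
by have [|] := Av x Ax; [right|left].
Qed.

Hypothesis ge_anti : forall x y, ge x y -> ge y x -> x = y.

Lemma chain_set_last A (P : D -> Prop) : chain_set ge A -> (exists2 q, A q & P q) ->
  exists q, [/\ A q, P q & forall q', A q' -> P q' -> ge q' q].
Proof.
move=> Ac [q0 Aq0 Pq0].
have Bc : chain_set ge (A `&` P) by apply: chain_set_sub Ac; [move=> q []|exists q0].
have [p [t [tm _ tE]]] := chain_set_enum ge_refl ge_trans Bc.
have [At Pt] : (A `&` P) (t ord_max) by rewrite -tE; exists ord_max.
exists (t ord_max); split => // q' Aq' Pq'.
have [i _ <-] : range t q' by rewrite tE.
by apply: tm; exact: leq_ord.
Qed.

Lemma chain_set_first A (P : D -> Prop) : chain_set ge A -> (exists2 q, A q & P q) ->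
  exists q, [/\ A q, P q & forall q', A q' -> P q' -> ge q q'].
Proof.
move=> Ac [q0 Aq0 Pq0].
have Bc : chain_set ge (A `&` P) by apply: chain_set_sub Ac; [move=> q []|exists q0].
have [p [t [tm _ tE]]] := chain_set_enum ge_refl ge_trans Bc.
have [At Pt] : (A `&` P) (t ord0) by rewrite -tE; exists ord0.
exists (t ord0); split => // q' Aq' Pq'.
have [i _ <-] : range t q' by rewrite tE.
exact: tm.
Qed.

Context {d : Order.disp_t} {C : porderType d} (rho : D -> C).
Variables (K0 K : set (set D)) (pv : set D -> D) (mu : set D -> nat)
  (wt : set D -> D -> nat).
Hypothesis K_chain : forall A, K A -> chain_set ge A.
Hypothesis K0K : K0 `<=` K.
Hypothesis K0_down : down_closed K0.
Hypothesis K_down : down_closed K.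
Hypothesis pv_add : forall A, K A -> ~ K0 A ->
  [/\ K (pv A |` A), pv (pv A |` A) = pv A, mu (pv A |` A) = mu A &
      wt (pv A |` A) = wt A].
Hypothesis pv_rem : forall A, K A -> ~ K0 A -> A (pv A) ->
  [/\ ~ K0 (A `\ pv A), pv (A `\ pv A) = pv A &
      exists q, [/\ A q, q <> pv A & (rho q <= rho (pv A))%O]].
Hypothesis pv_face : forall A w, K A -> ~ K0 A -> A (pv A) -> A w -> w <> pv A ->
  ~ K0 (A `\ w) -> (mu (A `\ w) < mu A)%N \/
    [/\ mu (A `\ w) = mu A, wt (A `\ w) = wt A, (0 < wt A w)%N &
        pv (A `\ w) = pv A \/ (wt A (pv (A `\ w)) < wt A w)%N].

(* Adding the weight of [pv A] makes the measure constant on matched pairs. *)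
Lemma pivot_collapse :
  collapse ge rho K0 K pv mu (fun A => wsum (wt A) (pv A |` A)).
Proof.
split => // [A KA nA|A w KA nA Av Aw wv nAw].
  have [h1 h2 h3 h4] := pv_add KA nA; split => //.
  by rewrite h2 h4 setUA setUid.
have [|[h1 h2 h3 h4]] := pv_face KA nA Av Aw wv nAw; [by left|right].
have [Af _ _] := K_chain KA.
split => //; rewrite (setU1_id Av) h2 (wsumD1 _ Af Aw).
have Awf : finite_set (A `\ w) by apply: sub_finite_set Af => x [].
case: h4 => [->|h4].
  rewrite setU1_id; first by rewrite -[ltnLHS]add0n ltn_add2r.
  by split => // /esym.
by apply: leq_ltn_trans (leq_wsumU1 _ _ Awf) _; rewrite ltn_add2r.
Qed.

End Chains.

Section Matchings.
Context {dC dJ : Order.disp_t} {C : porderType dC} {J : porderType dJ}.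
Variables (S : set C) (JS : set J) (O : J -> set C) (a b : nat) (c0 : C).
Hypothesis O_sub : forall j, JS j -> O j `<=` S.

Local Notation Z := (@cyl dC dJ C J).
Local Notation D := (pvertex Z a b).
Local Notation ge := (@pge Z cyl_ge a b).
Local Notation rho := (fun x : D => cyl_pt x.1).
Local Notation KWD := (prism_complex (Z := Z) cyl_ge (a := a) (b := b) (KW S JS O)).

Lemma pge_refl (x : D) : ge x x.
Proof. by split => //; exact: cyl_ge_refl. Qed.

Lemma pge_anti (x y : D) : ge x y -> ge y x -> x = y.
Proof.
case: x y => [x [x1 x2]] [y [y1 y2]] [/= xy xy1 xy2] [/= yx yx1 yx2].
by congr (_, (_, _)); [exact: cyl_ge_anti|apply/val_inj/anti_leq/andP..].
Qed.

Lemma pge_trans (y x z : D) : ge x y -> ge y z -> ge x z.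
Proof.
move=> [xy xy1 xy2] [yz yz1 yz2].
by split; [exact: cyl_ge_trans yz|exact: leq_trans yz1|exact: leq_trans yz2].
Qed.

Lemma KWD_chain A : KWD A -> chain_set ge A.
Proof. by case. Qed.

Lemma prism_complex_down (K : set (set Z)) : down_closed K ->
  down_closed (prism_complex cyl_ge (a := a) (b := b) K).
Proof.
move=> Kd A B AB A0 [Bc KB]; split; first exact: chain_set_sub Bc.
apply: Kd KB; first exact: image_subset.
by have [q Aq] := A0; exists q.1, q.
Qed.

Lemma prism_base_down (K K1 : set (set Z)) : down_closed K -> down_closed K1 ->
  down_closed (prism_base cyl_ge (a := a) (b := b) K1 K).
Proof.
move=> Kd K1d A B AB A0 [KB B1]; split; first exact: prism_complex_down KB.
case: B1 => [B1|[[t h]|[t h]]]; [left|right; left|right; right].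
- apply: K1d B1; first exact: image_subset.
  by have [q Aq] := A0; exists q.1, q.
- by exists t => q /AB; exact: h.
- by exists t => q /AB; exact: h.
Qed.

Lemma prism_base_sub (K K1 : set (set Z)) :
  prism_base cyl_ge (a := a) (b := b) K1 K `<=` prism_complex cyl_ge K.
Proof. by move=> A []. Qed.

(** Each pivot shares its prism coordinates with another vertex of the chain, so removing it does
    not push the chain into the boundary of the prism. *)
Lemma missed_setD1 (A : set D) v q : A q -> q <> v -> q.2 = v.2 ->
  missed (A `\ v) -> missed A.
Proof.
move=> Aq qv e [[t h]|[t h]]; [left|right]; exists t => q' Aq'.
- by have [->|q'v] := pselect (q' = v); [rewrite -e|]; apply: h.
- by have [->|q'v] := pselect (q' = v); [rewrite -e|]; apply: h.
Qed.

Lemma KWDP A : KWD A <-> [/\ chain_set ge A, forall q, A q -> S q.1.2 &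
  forall j c s j' c' s', A ((Some j, c), s) -> A ((Some j', c'), s') -> JS j /\ O j c'].
Proof.
split=> [[Ac [A1 A2]]|[Ac A1 A2]].
  split => // [q Aq|j c s j' c' s' Aq Aq']; first by apply: A1; exists q.
  by apply: (A2 _ j' c c'); [exists ((Some j, c), s)|exists ((Some j', c'), s')].
split => //; split => [_ [q Aq <-]|j j' c c' [[z s] Aq /= e] [[z' s'] Aq' /= e']].
  exact: A1.
by subst z z'; exact: A2 Aq Aq'.
Qed.

Lemma KX_fst (A : set D) : KWD A ->
  KX S JS O (fst @` A) <-> forall q, A q -> q.1.1 = None.
Proof.
move=> [_ KA]; split=> [[_ h] q Aq|h]; first by apply: h; exists q.
by split => // _ [q Aq <-]; exact: h.
Qed.

Lemma KY_fst (A : set D) : KWD A ->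
  KY S JS O (fst @` A) <-> forall q, A q -> q.1.1 <> None.
Proof.
move=> [_ KA]; split=> [[_ h] q Aq|h]; first by apply: h; exists q.
by split => // _ [q Aq <-]; exact: h.
Qed.

(** Default for the choices made by [xget]; on the chains to be matched, the vertex looked for
    exists. *)
Definition pv0 : D := ((None, c0), (ord0, ord0)).

(** * Matching relative to the chains of the base of the cylinder *)

Section MatchingX.
Local Notation K0 := (prism_base (Z := Z) cyl_ge (a := a) (b := b) (KX S JS O) (KW S JS O)).

Lemma nK0X A : KWD A -> ~ K0 A -> (exists2 q, A q & q.1.1 <> None) /\ ~ missed A.
Proof.
move=> KA nA; split; last by move=> mA; apply: nA; split => //; right.
apply: contrapT => h; apply: nA; split => //; left; apply/KX_fst => // q Aq.
by apply: contrapT => hq; apply: h; exists q.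
Qed.

Definition last_some (A : set D) q := [/\ A q, q.1.1 <> None &
  forall q', A q' -> q'.1.1 <> None -> ge q' q].

Lemma last_some_uniq A q q' : last_some A q -> last_some A q' -> q = q'.
Proof. by move=> [Aq q1 q2] [Aq' q1' q2']; apply: pge_anti; [exact: q2'|exact: q2]. Qed.

Definition flat (q : D) : D := ((None, q.1.2), q.2).

(** The copy in the base of the lowest pair of the chain. It fits just below that pair: the base
    vertices are below the pair, and between a pair and a base vertex only the open sets and the
    prism coordinates are compared, so they are below its copy too. *)
Definition pvX A := flat (xget pv0 (last_some A)).

Lemma pvXE A q : last_some A q -> pvX A = flat q.
Proof.
by move=> hq; rewrite /pvX (xget_unique _ hq) // => y hy; exact: last_some_uniq hy hq.
Qed.

Lemma last_some_ex A : KWD A -> ~ K0 A -> exists q, last_some A q.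
Proof.
move=> KA /(nK0X KA)[h _].
by have := chain_set_last pge_trans pge_refl (KWD_chain KA) h.
Qed.

Lemma last_someP A A' q : last_some A q -> A' q ->
  (forall q', A' q' -> q'.1.1 <> None -> A q') -> last_some A' q.
Proof. by move=> [Aq q1 q2] A'q h; split => // q' A'q' q'1; apply: q2 => //; exact: h. Qed.

(** Pairs weigh 2 and base vertices 1. The pivot changes only when the lowest pair is removed; the
    new pivot, a base vertex, then weighs less than the pair that was removed. *)
Lemma collapseX : collapse ge rho K0 KWD pvX (fun=> 0%N)
  (fun A => wsum (fun q => if q.1.1 is None then 1 else 2)%N (pvX A |` A)).
Proof.
apply: (@pivot_collapse _ ge _ _ rho K0 KWD pvX (fun=> 0%N)
  (fun _ q => if q.1.1 is None then 1 else 2)%N).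
- exact: KWD_chain.
- exact: prism_base_sub.
- by apply: prism_base_down; [exact: KW_down|exact: KX_down].
- by apply: prism_complex_down; exact: KW_down.
- move=> A KA nA; have [q hq] := last_some_ex KA nA; have [Aq q1 q2] := hq.
  have [Ac A1 A2] := (KWDP A).1 KA.
  split => //; rewrite (pvXE hq); last first.
    by apply: pvXE; apply: last_someP hq _ _; [right|move=> q' [->|]].
  have qv : ge q (flat q) by split => //; split => //=; case: q.1.1.
  apply/KWDP; split.
  + apply: (chain_setU1 pge_refl Ac) => q' Aq'.
    have [e|e] := pselect (q'.1.1 = None); last first.
      by right; apply: pge_trans qv; exact: q2.
    left; have [_ _ At] := Ac.
    have [[[h1 h2] h3 h4]|[[_ +] _ _]] := At _ _ Aq Aq'; last first.
      by rewrite e; case: q.1.1 q1.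
    by split => //; split => //=; rewrite e.
  + by move=> q' [->|/A1//]; exact: A1 Aq.
  + by move=> j c s j' c' s' [//|Aj] [//|Aj']; exact: A2 Aj Aj'.
- move=> A KA nA; have [q hq] := last_some_ex KA nA; have [Aq q1 q2] := hq.
  rewrite (pvXE hq) => Av; have qv : q <> flat q by move=> e; apply: q1; rewrite e.
  split.
  + have [_ nm] := nK0X KA nA.
    move=> [KA' [/(KX_fst KA') h|]]; first by apply: q1; apply: h.
    by move=> /(missed_setD1 Aq qv erefl).
  + by apply: pvXE; apply: last_someP hq _ _ => // q' [].
  + by exists q.
- move=> A w KA nA; have [q hq] := last_some_ex KA nA; have [Aq q1 q2] := hq.
  rewrite (pvXE hq) => Av Aw wv nAw; right.
  have KAw : KWD (A `\ w).
    apply: (prism_complex_down (@KW_down _ _ _ _ S JS O) _ _ KA); first by move=> x [].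
    by exists (flat q); split => // /esym.
  split => //; first by case: w.1.1.
  have [qw|qw] := pselect (q = w).
    right; have [q' hq'] := last_some_ex KAw nAw.
    by rewrite (pvXE hq') -qw /=; case: q.1.1 q1.
  left; apply: pvXE; apply: last_someP hq _ _ => //; by move=> q' [].
Qed.

End MatchingX.

(** * Matching relative to the chains of pairs *)

Section MatchingY.
Local Notation K0 := (prism_base (Z := Z) cyl_ge (a := a) (b := b) (KY S JS O) (KW S JS O)).
Variables (top : C -> J) (core : C -> C -> C) (meet : J -> J -> J).
Hypothesis top_JS : forall V, S V -> JS (top V).
Hypothesis top_O : forall V, S V -> O (top V) V.
Hypothesis core_ge : forall V W, S V -> S W -> (V <= W)%O -> (V <= core V W)%O.
Hypothesis core_le : forall V W, S V -> S W -> (V <= W)%O -> (core V W <= W)%O.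
Hypothesis core_id : forall V W, S V -> S W -> (V <= W)%O -> core V (core V W) = core V W.
Hypothesis core_top : forall V W, S V -> S W -> (V <= W)%O -> O (top V) (core V W).
Hypothesis core_O : forall V W j, S V -> S W -> (V <= W)%O -> JS j -> O j W -> O j (core V W).
Hypothesis core_mono : forall V W W', S V -> S W -> S W' -> (V <= W)%O -> (W <= W')%O ->
  (core V W <= core V W')%O.
Hypothesis meet_l : forall j j', (meet j j' <= j)%O.
Hypothesis meet_r : forall j j', (meet j j' <= j')%O.
Hypothesis meet_glb : forall i j j', (i <= j)%O -> (i <= j')%O -> (i <= meet j j')%O.
Hypothesis meet_JS : forall j j', JS j -> JS (meet j j').
Hypothesis meet_O : forall j j' c, O j c -> O j' c -> O (meet j j') c.

Lemma core_self V : S V -> core V V = V.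
Proof. by move=> SV; apply: le_anti; apply/andP; split; [exact: core_le|exact: core_ge]. Qed.

(* The contraction of the poset of pairs (j, W) with W in O j and V <= W is the
   zigzag (j, W) >= (j, core W) >= (meet j (top V), core W) <= (top V, core W)
   >= (top V, V); the level of (j, W) is the number of steps still to go, and
   [next] performs the first one of them. *)
Definition lev V (q : D) : nat :=
  if q.1.1 is Some j then
    if core V q.1.2 != q.1.2 then 4%N
    else if ~~ (j <= top V)%O then 3%N
    else if j != top V then 2%N
    else (q.1.2 != V : nat)
  else 0%N.

Definition next V (q : D) : D :=
  if q.1.1 is Some j then
    if core V q.1.2 != q.1.2 then ((Some j, core V q.1.2), q.2)
    else if ~~ (j <= top V)%O then ((Some (meet j (top V)), q.1.2), q.2)
    else if j != top V then ((Some (top V), q.1.2), q.2)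
    else ((Some (top V), V), q.2)
  else q.

Lemma next_2 V q : (next V q).2 = q.2.
Proof. by rewrite /next; case: q.1.1 => [j|//]; do 3 case: ifP => _ //. Qed.

Lemma lev_le4 V q : (lev V q <= 4)%N.
Proof. by rewrite /lev; case: q.1.1 => [j|//]; do 3 case: ifP => _ //; case: (_ != _). Qed.

Lemma lev_le3 V j W s : (lev V ((Some j, W), s) <= 3)%N -> core V W = W.
Proof. by rewrite /lev /=; have [] := eqVneq (core V W) W. Qed.

Lemma lev_le2 V j W s : (lev V ((Some j, W), s) <= 2)%N -> (j <= top V)%O.
Proof.
by rewrite /lev /=; have [_|_] := eqVneq (core V W) W => //=; case: (_ <= _)%O.
Qed.

Lemma lev_le1 V j W s : (lev V ((Some j, W), s) <= 1)%N -> j = top V.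
Proof.
rewrite /lev /=; have [_|_] := eqVneq (core V W) W => //=.
by case: (_ <= _)%O => //=; have [] := eqVneq j (top V).
Qed.

Lemma lev_le0 V j W s : (lev V ((Some j, W), s) <= 0)%N -> W = V.
Proof.
rewrite /lev /=; have [_|_] := eqVneq (core V W) W => //=.
case: (_ <= _)%O => //=; have [_|_] := eqVneq j (top V) => //=.
by have [] := eqVneq W V.
Qed.

Lemma lev_top V s : S V -> lev V ((Some (top V), V), s) = 0%N.
Proof. by move=> SV; rewrite /lev /= core_self // !eqxx lexx. Qed.

Lemma lev_next V j W s : S V -> S W -> (V <= W)%O -> (0 < lev V ((Some j, W), s))%N ->
  (lev V (next V ((Some j, W), s)) < lev V ((Some j, W), s))%N.
Proof.
move=> SV SW VW; rewrite /next {1 3}/lev /=.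
have [e|ne] := eqVneq (core V W) W; last first.
  rewrite /lev /= core_id // eqxx /=.
  by do 2 case: ifP => _ //; case: (_ != _).
have [jt|jt] := boolP (j <= top V)%O; last first.
  by rewrite /lev /= e eqxx /= meet_r /=; case: ifP => _ //; case: (_ != _).
have [jt'|jt'] := eqVneq j (top V); last first.
  by rewrite /lev /= e eqxx /= lexx eqxx /=; case: (_ != _).
by rewrite lev_top //=; case: (_ != _).
Qed.

Definition first_none (A : set D) z := [/\ A z, z.1.1 = None &
  forall z', A z' -> z'.1.1 = None -> ge z z'].

Lemma first_none_uniq A z z' : first_none A z -> first_none A z' -> z = z'.
Proof. by move=> [Az z1 z2] [Az' z1' z2']; apply: pge_anti; [exact: z2|exact: z2']. Qed.

(** The step is applied at the end of the block of maximal level towards which it moves: the lowest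
    vertex for the steps that go down, the highest one at level 2, where the index goes up. The
    result is then comparable with the whole chain. *)
Definition pivot V (A : set D) q := [/\ A q, (0 < lev V q)%N & forall q', A q' ->
  (lev V q' <= lev V q)%N /\
  (lev V q' = lev V q -> if lev V q == 2%N then ge q q' else ge q' q)].

Lemma pivot_uniq V A q q' : pivot V A q -> pivot V A q' -> q = q'.
Proof.
move=> [Aq _ h] [Aq' _ h'].
have [l1 h1] := h _ Aq'; have [l2 h2] := h' _ Aq.
have e : lev V q = lev V q' by apply/eqP; rewrite eqn_leq l1 l2.
move: (h1 (esym e)) (h2 e); rewrite e.
by case: ifP => _ h3 h4; exact: pge_anti.
Qed.

(** [V] is the largest open set of the base part, so that all the pairs of the chain lie above it.
    When every level is 0, no step remains and the end point of the contraction is used, with the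
    prism coordinates of [z]. *)
Definition toggle (A : set D) v := exists2 z, first_none A z &
  let V := z.1.2 in (exists2 q, pivot V A q & v = next V q) \/
  ((forall q, A q -> lev V q = 0%N) /\ v = ((Some (top V), V), z.2)).

Lemma toggle_uniq A v v' : toggle A v -> toggle A v' -> v = v'.
Proof.
move=> [z hz tz] [z' hz']; rewrite (first_none_uniq hz' hz).
case: tz => [[q hq ->]|[h ->]] [[q' hq' ->]|[h' ->]] //.
- by rewrite (pivot_uniq hq hq').
- by case: hq => Aq; rewrite h'.
- by case: hq' => Aq; rewrite h.
Qed.

Lemma nK0Y A : KWD A -> ~ K0 A -> (exists2 q, A q & q.1.1 = None) /\ ~ missed A.
Proof.
move=> KA nA; split; last by move=> mA; apply: nA; split => //; right.
apply: contrapT => h; apply: nA; split => //; left; apply/KY_fst => // q Aq.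
by move=> hq; apply: h; exists q.
Qed.

Lemma first_none_ex A : KWD A -> ~ K0 A -> exists z, first_none A z.
Proof.
move=> KA /(nK0Y KA)[h _].
by have := chain_set_first pge_trans pge_refl (KWD_chain KA) h.
Qed.

Lemma toggle_ex A : KWD A -> ~ K0 A -> exists v, toggle A v.
Proof.
move=> KA nA; have [z hz] := first_none_ex KA nA.
set V := z.1.2; have Ac := KWD_chain KA.
have [h|h] := pselect (forall q, A q -> lev V q = 0%N).
  by exists ((Some (top V), V), z.2), z => //; right.
have [q0 Aq0 l0] : exists2 q, A q & (0 < lev V q)%N.
  apply: contrapT => h'; apply: h => q Aq; apply/eqP; rewrite -leqn0 leqNgt.
  by apply/negP => l0; apply: h'; exists q.
have ex : exists n, `[< exists2 q, A q & lev V q = n >].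
  by exists (lev V q0); apply/asboolP; exists q0.
have ub n : `[< exists2 q, A q & lev V q = n >] -> (n <= 4)%N.
  by move=> /asboolP[q _ <-]; exact: lev_le4.
case: (ex_maxnP ex ub) => n /asboolP hn nmax.
have mx q : A q -> (lev V q <= n)%N by move=> Aq; apply: nmax; apply/asboolP; exists q.
have n0 : (0 < n)%N := leq_trans l0 (mx _ Aq0).
have [n2|n2] := eqVneq n 2%N.
  have [q [Aq qn qf]] := chain_set_first pge_trans pge_refl Ac hn.
  exists (next V q), z => //; left; exists q => //; split => //; first by rewrite qn.
  by move=> q' Aq'; rewrite qn; split; [exact: mx|move=> q'n; rewrite n2 /=; exact: qf].
have [q [Aq qn ql]] := chain_set_last pge_trans pge_refl Ac hn.
exists (next V q), z => //; left; exists q => //; split => //; first by rewrite qn.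
move=> q' Aq'; rewrite qn; split; [exact: mx|move=> q'n; rewrite (negbTE n2)].
exact: ql.
Qed.

Section Insertion.
Variables (A : set D) (z : D).
Hypothesis KA : KWD A.
Hypothesis hz : first_none A z.
Let V := z.1.2.

Let SV : S V.
Proof. by have [Az _ _] := hz; have [_ h _] := (KWDP A).1 KA; exact: h. Qed.

Let some_ge_none q q' : A q -> A q' -> q.1.1 <> None -> q'.1.1 = None -> ge q q'.
Proof.
move=> Aq Aq' q1 q1'; have [[_ _ At] _ _] := (KWDP A).1 KA.
have [//|[[_ +] _ _]] := At _ _ Aq Aq'.
by rewrite q1'; case: q.1.1 q1.
Qed.

Lemma some_facts j W s : A ((Some j, W), s) -> [/\ JS j, S W, (V <= W)%O & O j W].
Proof.
move=> Aq; have [_ h1 h2] := (KWDP A).1 KA; have [Az z1 _] := hz.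
have [Jj OW] := h2 _ _ _ _ _ _ Aq Aq; split => //; first exact: h1 Aq.
by have [|[]] := some_ge_none Aq Az _ z1.
Qed.

(** The vertex with the prism coordinates of [v] is the pivot that produced it, different from [v]
    because a step lowers the level, or else [z], which is not a pair. *)
Lemma toggle_levels v : toggle A v -> exists j W s, [/\ v = ((Some j, W), s),
  (V <= W)%O & exists q, [/\ A q, q <> v & q.2 = v.2]].
Proof.
move=> [z' hz']; rewrite (first_none_uniq hz' hz) -/V.
move=> [[[[[j|] W] s] hq ->]|[_ ->]]; last 1 first.
- have [Az z1 _] := hz; exists (top V), V, z.2; split => //.
  by exists z; split => // e; rewrite e in z1.
- have [Aq l0 _] := hq; have [Jj SW VW OW] := some_facts Aq.
  have ll := lev_next SV SW VW l0.
  have ex : exists q, [/\ A q, q <> next V ((Some j, W), s) & q.2 = (next V ((Some j, W), s)).2].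
    exists ((Some j, W), s); split => //; last by rewrite next_2.
    by move=> e; rewrite -e ltnn in ll.
  rewrite /next /= in ex *; move: ex.
  case: ifP => _ /=; first by move=> ex; do 3 eexists; split; [by []|exact: core_ge|exact: ex].
  case: ifP => _ /=; first by move=> ex; do 3 eexists; split; [by []|exact: VW|exact: ex].
  case: ifP => _ /=; first by move=> ex; do 3 eexists; split; [by []|exact: VW|exact: ex].
  by move=> ex; do 3 eexists; split; [by []|exact: lexx|exact: ex].
- by case: hq => _; rewrite /lev.
Qed.

(** The order of the steps matters here. Passing to the core preserves membership in every [O j'].
    The index moves towards [top V] only when the maximal level is at most 3: all the open sets of
    pairs are then cores, hence in [O (top V)]. The open set becomes [V] only when all the indices
    are [top V], and [top_O] applies. *)
Lemma toggle_O v j W s : toggle A v -> v = ((Some j, W), s) ->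
  [/\ JS j, O j W, (forall j' W' s', A ((Some j', W'), s') -> O j W') &
      (forall j' W' s', A ((Some j', W'), s') -> O j' W)].
Proof.
move=> [z' hz']; rewrite (first_none_uniq hz' hz) -/V.
have [_ _ AO] := (KWDP A).1 KA.
have topA j' W' s' : A ((Some j', W'), s') -> core V W' = W' -> O (top V) W'.
  by move=> Aq' e; have [Jj SW VW OW] := some_facts Aq'; rewrite -e; exact: core_top.
move=> [[[[[i|] U] r] [Aq l0 mx] ->]|[h0 ->] [<- <- _]]; last 1 first.
- split; [exact: top_JS|exact: top_O|..] => j' W' s' Aq'.
    by apply: (topA _ _ _ Aq'); have := h0 _ Aq' => e; apply: (@lev_le3 _ j' _ s'); rewrite e.
  have e := h0 _ Aq'; rewrite (@lev_le1 V j' W' s') ?e //; exact: top_O.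
- have [Ji SU VU OU] := some_facts Aq.
  have {}mx j' W' s' : A ((Some j', W'), s') -> (lev V ((Some j', W'), s') <= lev V ((Some i, U), r))%N.
    by move=> /mx[].
  move: mx; rewrite /next {2}/lev /=.
  have [e|ne] := eqVneq (core V U) U => /= mx; last first.
    move=> [<- <- _]; split => //; [exact: core_O|..] => j' W' s' Aq'.
      by have [] := AO _ _ _ _ _ _ Aq Aq'.
    by have [Jj' _] := AO _ _ _ _ _ _ Aq' Aq; apply: core_O => //; have [] := AO _ _ _ _ _ _ Aq' Aq.
  have UO j' W' s' : A ((Some j', W'), s') -> O j' U.
    by move=> Aq'; have [] := AO _ _ _ _ _ _ Aq' Aq.
  have UO' j' W' s' : A ((Some j', W'), s') -> O i W'.
    by move=> Aq'; have [] := AO _ _ _ _ _ _ Aq Aq'.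
  move: mx; have [it|it] := boolP (i <= top V)%O => /= mx; last first.
    have tO j' W' s' : A ((Some j', W'), s') -> O (top V) W'.
      by move=> Aq'; apply: (topA _ _ _ Aq'); exact: lev_le3 (mx _ _ _ Aq').
    move=> [<- <- _]; split; [exact: meet_JS|by apply: meet_O => //; exact: tO Aq| |exact: UO].
    by move=> j' W' s' Aq'; apply: meet_O; [exact: UO' Aq'|exact: tO Aq'].
  have tO j' W' s' : A ((Some j', W'), s') -> O (top V) W'.
    move=> Aq'; apply: (topA _ _ _ Aq'); apply: lev_le3 (leq_trans (mx _ _ _ Aq') _).
    by case: (_ != _) => //; case: (_ != _).
  move: mx; have [it'|it'] := eqVneq i (top V) => /= mx; last first.
    by move=> [<- <- _]; split; [exact: top_JS|exact: tO Aq|exact: tO|exact: UO].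
  move=> [<- <- _]; split; [exact: top_JS|exact: top_O|exact: tO|].
  move=> j' W' s' Aq'; rewrite (@lev_le1 V j' W' s'); first exact: top_O.
  by apply: leq_trans (mx _ _ _ Aq') _; case: (_ != _).
- by case: (l0).
Qed.

Lemma toggle_comparable v q' : toggle A v -> A q' -> ge v q' \/ ge q' v.
Proof.
move=> tv Aq'; have [j [W [s [ev VW _]]]] := toggle_levels tv.
have [Az z1 zf] := hz.
have [[j' [W' [s' e']]]|n'] : (exists j' W' s', q' = ((Some j', W'), s')) \/ q'.1.1 = None.
  by case: q' {Aq'} => [[[j'|] W'] s']; [left; exists j', W', s'|right].
all: move: tv => [z' hz']; rewrite (first_none_uniq hz' hz) -/V => tv.
- subst q'; have [Jj' SW' VW' OW'] := some_facts Aq'.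
  case: tv => [[[[[i|] U] r] [Aq l0 mx] e]|[h0 e]]; last 1 first.
  + have := h0 _ Aq'; right.
    have ll : (lev V ((Some j', W'), s') <= 0)%N by rewrite h0.
    rewrite e (lev_le1 (leq_trans ll (leq0n 1))) (lev_le0 ll).
    have [|_ h3 h4] := some_ge_none Aq' Az _ z1; first by [].
    by split => //; split => /=.
  + have [Ji SU VU OU] := some_facts Aq.
    have [le_l eq_l] := mx _ Aq'.
    have [[_ _ At] _ _] := (KWDP A).1 KA.
    have cmp := At _ _ Aq Aq'.
    (* For the steps that go down: a vertex of the same level is above the pivot, hence above its
       image; a vertex of lower level below the pivot already satisfies what the step achieves, so
       it stays below the image. *)
    have below : ge ((Some i, U), r) (next V ((Some i, U), r)) -> 
        lev V ((Some i, U), r) != 2%N ->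
        (ge ((Some i, U), r) ((Some j', W'), s') -> 
         (lev V ((Some j', W'), s') < lev V ((Some i, U), r))%N ->
         ge (next V ((Some i, U), r)) ((Some j', W'), s')) ->
        ge v ((Some j', W'), s') \/ ge ((Some j', W'), s') v.
      move=> h1 h2 h3; rewrite e; have [lt|eq] := ltnP (lev V ((Some j', W'), s')) (lev V ((Some i, U), r)).
        by case: cmp => [/h3|/pge_trans]; [left; auto|right; auto].
      right; apply: pge_trans h1; move: eq_l; rewrite (negbTE h2); apply.
      by apply/eqP; rewrite eqn_leq le_l.
    have EL := erefl (lev V ((Some i, U), r)); rewrite {2}/lev /= in EL.
    rewrite e EL /next /= in below le_l eq_l *; move: below le_l eq_l => {EL}.
    have [eU|neU] := eqVneq (core V U) U => /=; last first.
      move=> + _ _; apply => //.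
        by split => //; split => //=; exact: core_le.
      move=> [[/= h1 h2] h3 h4] ll; split => //; split => //=.
      have <- : core V W' = W' by apply: (@lev_le3 V j' W' s').
      exact: core_mono.
    have [it|it] := boolP (i <= top V)%O => /=; last first.
      move=> + _ _; apply => //.
        by split => //; split => //=; exact: meet_l.
      move=> [[/= h1 h2] h3 h4] ll; split => //; split => //=.
      by apply: meet_glb => //; apply: (@lev_le2 V j' W' s').
    have [it'|it'] := eqVneq i (top V) => /=; last first.
      (* The step that goes up: the other vertices of level 2 are below the pivot, and a vertex of
         lower level above the pivot already has index [top V], so it is above the image. *)
      move=> _ le_l eq_l.
      have up : ge ((Some (top V), U), r) ((Some i, U), r) by split => //; split.
      case: cmp => [h|h]; first by left; exact: pge_trans h.
      have [lt|eq] := ltnP (lev V ((Some j', W'), s')) 2%N; last first.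
        left; apply: pge_trans up _; apply: eq_l.
        by apply/eqP; rewrite eqn_leq le_l.
      right; rewrite (@lev_le1 V j' W' s') //.
      by case: h => [[/= h1 h2] h3 h4]; split => //; split => //=; exact: lexx.
    have [UV|UV] := eqVneq U V.
      by move: l0; rewrite /lev /= eU it it' UV !eqxx.
    move=> + _ _; apply => //.
      by split => //; split => //=; rewrite it'.
    move=> [[/= h1 h2] h3 h4] ll; split => //; split => //=.
      by rewrite (@lev_le0 V j' W' s').
    by rewrite -it'.
  + by case: (l0).
(* A base vertex is below [v]: its open set is contained in [V], and the prism coordinates of [v]
   are those of the pivot or of [z], both above that base vertex. *)
- left; have [q [Aq qv q2]] : exists q, [/\ A q, q <> v & q.2 = v.2] by have [?[?[?[]]]] := toggle_levels (ex_intro2 _ _ z hz tv).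
  have zq : ge z q' := zf _ Aq' n'.
  have qq' : (v.2.1 <= q'.2.1)%N /\ (v.2.2 <= q'.2.2)%N.
    rewrite -q2; have [qn|qn] := pselect (q.1.1 = None); last first.
      by have [] := some_ge_none Aq Aq' qn n'.
    case: tv => [[p [Ap lp _] e]|[_ e]].
      have -> : q.2 = p.2 by rewrite q2 e next_2.
      by have [] : ge p q' by apply: some_ge_none => //; move: lp; rewrite /lev; case: p.1.1.
    by rewrite q2 e; case: zq.
  case: qq' => h1 h2; split => //; rewrite ev /cyl_ge /= n'; split => //.
  by case: zq => -[zq _] _ _; exact: le_trans zq VW.
Qed.

End Insertion.
Definition pvY A := xget pv0 (toggle A).

Lemma pvYE A v : toggle A v -> pvY A = v.
Proof. by move=> hv; apply: (xget_unique _ hv) => y hy; exact: toggle_uniq hy hv. Qed.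

(** The dominant measure, because removing a base vertex may change [V] and with it all the
    levels. *)
Definition none_count (A : set D) := wsum (fun q => (q.1.1 == None) : nat) A.

(** The successor gives a positive weight to the vertices of level 0 as well. *)
Definition lev_weight (A : set D) q := (lev (xget pv0 (first_none A)).1.2 q).+1.

Lemma lev_weightE A z q : first_none A z -> lev_weight A q = (lev z.1.2 q).+1.
Proof.
by move=> hz; rewrite /lev_weight (xget_unique _ hz) // => y hy; exact: first_none_uniq hy hz.
Qed.

Lemma lev_some V (q : D) : (0 < lev V q)%N -> q.1.1 <> None.
Proof. by rewrite /lev; case: q.1.1. Qed.

Lemma first_noneP (A A' : set D) z : first_none A z -> A' z ->
  (forall q, A' q -> q.1.1 = None -> A q) -> first_none A' z.
Proof. by move=> [Az z1 z2] A'z h; split => // q A'q q1; apply: z2 => //; exact: h. Qed.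

(** The toggle depends only on the first base vertex and on the vertices of maximal level. This
    covers adding or removing the toggle itself and removing a pair that is not the pivot. *)
Lemma toggle_same A A' v z : first_none A z -> first_none A' z -> toggle A v ->
  (forall q, A' q -> A q \/ lev z.1.2 q = 0%N \/
     (exists2 p, pivot z.1.2 A p & (lev z.1.2 q < lev z.1.2 p)%N)) ->
  (forall p, pivot z.1.2 A p -> A' p) -> toggle A' v.
Proof.
move=> hz hz' [z0 hz0]; rewrite (first_none_uniq hz0 hz) => tv AA' A'p.
exists z => //; case: tv => [[p hp ->]|[h ->]].
  left; exists p => //; have [Ap l0 mx] := hp; split => //; first exact: A'p.
  move=> q /AA'[/mx//|[e|[p' hp' lt]]].
    by rewrite e; split => // e'; rewrite -e' in l0.
  rewrite (pivot_uniq hp hp'); split; first exact: ltnW.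
  by move=> e; rewrite e ltnn in lt.
right; split => // q /AA'[/h//|[//|[p [Ap l0 _] _]]].
by rewrite h in l0.
Qed.

(** A step lowers the level, so the toggle never takes over the part of the pivot it comes from. *)
Lemma toggle_lev A z v : KWD A -> first_none A z -> toggle A v ->
  lev z.1.2 v = 0%N \/ exists2 p, pivot z.1.2 A p & (lev z.1.2 v < lev z.1.2 p)%N.
Proof.
move=> KA hz [z0 hz0]; rewrite (first_none_uniq hz0 hz).
have SV : S z.1.2 by have [Az _ _] := hz; have [_ h _] := (KWDP A).1 KA; exact: h.
move=> [[p hp ->]|[_ ->]]; last by left; exact: lev_top.
right; exists p => //; have [Ap l0 _] := hp.
case: p hp Ap l0 => [[[j|] W] s] hp Ap l0; last by case: (lev_some l0).
have [Jj SW VW OW] := some_facts KA hz Ap; exact: lev_next.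
Qed.

Lemma none_count_some A v : finite_set A -> v.1.1 <> None ->
  none_count (v |` A) = none_count A.
Proof.
move=> Af /eqP/negbTE v1; have [Av|Av] := pselect (A v); first by rewrite setU1_id.
by rewrite /none_count wsumU1 // v1.
Qed.

Lemma toggle_add A : KWD A -> ~ K0 A -> [/\ KWD (pvY A |` A), pvY (pvY A |` A) = pvY A,
  none_count (pvY A |` A) = none_count A & lev_weight (pvY A |` A) = lev_weight A].
Proof.
move=> KA nA; have [v tv] := toggle_ex KA nA; rewrite (pvYE tv).
have [z hz] := first_none_ex KA nA; have [Az z1 z2] := hz.
have [j [W [s [ev VW [q [Aq qv q2]]]]]] := toggle_levels KA hz tv.
have [Jj OW h1 h2] := toggle_O KA hz tv ev.
have [Ac A1 A2] := (KWDP A).1 KA; have [Af _ _] := Ac.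
have v1 : v.1.1 <> None by rewrite ev.
have hz' : first_none (v |` A) z.
  by apply: (first_noneP hz); [right|move=> p [->|//] /v1].
split.
- apply/KWDP; split.
  + by apply: (chain_setU1 pge_refl Ac) => p Ap; exact: toggle_comparable hz _ _ tv Ap.
  + by move=> p [->|/A1//]; rewrite ev; exact: O_sub OW.
  + rewrite ev => i c r i' c' r' [[-> _ _]|Ap] [[_ -> _]|Ap'] //.
    * by split => //; exact: h1 Ap'.
    * by have [Ji _] := A2 _ _ _ _ _ _ Ap Ap; split => //; exact: h2 Ap.
    * exact: A2 Ap Ap'.
- apply: pvYE; apply: (toggle_same hz hz' tv); last by move=> p [Ap _ _]; right.
  by move=> p [->|]; [right; exact: toggle_lev|left].
- exact: none_count_some.
- by apply/funext => p; rewrite (lev_weightE _ hz) (lev_weightE _ hz').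
Qed.

(** The base vertex [z] survives the removal. It keeps the simplex out of the chains of pairs, and
    its open set [V] is contained in that of the toggle, as the horn filling demands. *)
Lemma toggle_rem A : KWD A -> ~ K0 A -> A (pvY A) ->
  [/\ ~ K0 (A `\ pvY A), pvY (A `\ pvY A) = pvY A &
      exists q, [/\ A q, q <> pvY A & (rho q <= rho (pvY A))%O]].
Proof.
move=> KA nA; have [v tv] := toggle_ex KA nA; rewrite (pvYE tv) => Av.
have [z hz] := first_none_ex KA nA; have [Az z1 z2] := hz.
have [j [W [s [ev VW [q [Aq qv q2]]]]]] := toggle_levels KA hz tv.
have zv : z <> v by move=> e; rewrite e ev in z1.
split; last by exists z; rewrite ev in zv *.
- move=> [KA' [/(KY_fst KA') h|]]; first by apply: (h z).
  by have [_ nm] := nK0Y KA nA => /(missed_setD1 Aq qv q2).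
- have hz' : first_none (A `\ v) z by apply: (first_noneP hz) => // p [].
  apply: pvYE; apply: (toggle_same hz hz' tv); first by move=> p []; left.
  move=> p hp; have [Ap _ _] := hp; split => // pv.
  have [e|[p' hp']] := toggle_lev KA hz tv.
    by case: hp => _; rewrite pv e.
  by rewrite (pivot_uniq hp' hp) pv ltnn.
Qed.

(** Removing a base vertex lowers [none_count], and removing a pair other than the pivot leaves the
    toggle unchanged. After removal of the pivot, the new toggle has level 0 or comes by a step from
    a level that is no higher, so it weighs less than the vertex removed. *)
Lemma toggle_face A w : KWD A -> ~ K0 A -> A (pvY A) -> A w -> w <> pvY A ->
  ~ K0 (A `\ w) -> (none_count (A `\ w) < none_count A)%N \/
  [/\ none_count (A `\ w) = none_count A, lev_weight (A `\ w) = lev_weight A,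
      (0 < lev_weight A w)%N &
      pvY (A `\ w) = pvY A \/ (lev_weight A (pvY (A `\ w)) < lev_weight A w)%N].
Proof.
move=> KA nA; have [v tv] := toggle_ex KA nA; rewrite (pvYE tv) => Av Aw wv nAw.
have [[Af _ _] _ _] := (KWDP A).1 KA.
have [w1|w1] := eqVneq w.1.1 None.
  by left; rewrite /none_count (wsumD1 _ Af Aw) w1 eqxx.
right; have [z hz] := first_none_ex KA nA; have [Az z1 z2] := hz.
have zw : z <> w by move=> e; rewrite -e z1 in w1.
have hz' : first_none (A `\ w) z by apply: (first_noneP hz) => // p [].
have KAw : KWD (A `\ w).
  apply: (prism_complex_down (@KW_down _ _ _ _ S JS O) _ _ KA); first by move=> x [].
  by exists v; split => // /esym.
split.
- by rewrite [RHS](wsumD1 _ Af Aw) (negbTE w1).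
- by apply/funext => p; rewrite (lev_weightE _ hz) (lev_weightE _ hz').
- by [].
- have [hw|hw] := pselect (pivot z.1.2 A w); last first.
    left; apply: pvYE; apply: (toggle_same hz hz' tv); first by move=> p []; left.
    by move=> p hp; have [Ap _ _] := hp; split => //= pw; rewrite pw in hp.
  right; have [v' tv'] := toggle_ex KAw nAw; rewrite (pvYE tv') !(lev_weightE _ hz) ltnS.
  have [_ lw mx] := hw.
  have [->//|[p [[Ap _] _ _] lt]] := toggle_lev KAw hz' tv'.
  by apply: leq_trans lt _; have [] := mx _ Ap.
Qed.

Lemma collapseY : collapse ge rho K0 KWD pvY none_count
  (fun A => wsum (lev_weight A) (pvY A |` A)).
Proof.
apply: (@pivot_collapse _ ge _ _ rho K0 KWD pvY none_count lev_weight).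
- exact: KWD_chain.
- exact: prism_base_sub.
- by apply: prism_base_down; [exact: KW_down|exact: KY_down].
- by apply: prism_complex_down; exact: KW_down.
- exact: toggle_add.
- exact: toggle_rem.
- exact: toggle_face.
Qed.

End MatchingY.
End Matchings.

(** * A cofinality theorem for iterated homotopy limits *)

Section Cofinality.
Context {dC dJ : Order.disp_t} {C : porderType dC} {J : porderType dJ}.
Context (F : presheaf C) (S : set C) (JS : set J) (O : J -> set C).
Hypothesis F_kan : space_valued F.
Hypothesis O_mono : forall j j' : J, (j <= j')%O -> O j `<=` O j'.
Hypothesis O_sub : forall j, JS j -> O j `<=` S.
Variables (c0 : C) (top : C -> J) (core : C -> C -> C) (meet : J -> J -> J).
Hypothesis top_JS : forall V, S V -> JS (top V).
Hypothesis top_O : forall V, S V -> O (top V) V.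
Hypothesis core_ge : forall V W, S V -> S W -> (V <= W)%O -> (V <= core V W)%O.
Hypothesis core_le : forall V W, S V -> S W -> (V <= W)%O -> (core V W <= W)%O.
Hypothesis core_id : forall V W, S V -> S W -> (V <= W)%O -> core V (core V W) = core V W.
Hypothesis core_top : forall V W, S V -> S W -> (V <= W)%O -> O (top V) (core V W).
Hypothesis core_O : forall V W j, S V -> S W -> (V <= W)%O -> JS j -> O j W -> O j (core V W).
Hypothesis core_mono : forall V W W', S V -> S W -> S W' -> (V <= W)%O -> (W <= W')%O ->
  (core V W <= core V W')%O.
Hypothesis meet_l : forall j j', (meet j j' <= j)%O.
Hypothesis meet_r : forall j j', (meet j j' <= j')%O.
Hypothesis meet_glb : forall i j j', (i <= j)%O -> (i <= j')%O -> (i <= meet j j')%O.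
Hypothesis meet_JS : forall j j', JS j -> JS (meet j j').
Hypothesis meet_O : forall j j' c, O j c -> O j' c -> O (meet j j') c.

Theorem holim_cover_weak_equiv
  (fc : forall (j j' : J) (Sj : JS j) (Sj' : JS j') (h : (j' <= j)%O) n (x : holim S F n),
    holim_sub F (O_sub Sj') n x =
    fres (holim_presheaf O_mono F) h n (holim_sub F (O_sub Sj) n x)) :
  weak_equiv (@holim_cone _ _ JS (holim_presheaf O_mono F) (holim S F)
    (fun j Sj => holim_sub F (O_sub Sj)) fc).
Proof.
apply: cofinal_weak_equiv.
- apply: (sect_restrict_trivial_fibration F_kan (@cyl_ge_refl _ _ _ _)
    (@cyl_ge_anti _ _ _ _) (@cyl_ge_trans _ _ _ _)) => a b.
  by do 3 eexists; exact: (collapseX S JS O a b c0).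
- apply: (sect_restrict_trivial_fibration F_kan (@cyl_ge_refl _ _ _ _)
    (@cyl_ge_anti _ _ _ _) (@cyl_ge_trans _ _ _ _)) => a b.
  by do 3 eexists; exact: (collapseY a b c0 O_sub top_JS top_O core_ge core_le core_id core_top core_O
    core_mono meet_l meet_r meet_glb meet_JS meet_O).
Qed.

End Cofinality.

(** * Balls in a manifold *)

Section Balls.
Variable R : realType.

(** The ball is star-shaped: a union of segments through 0. *)
Lemma euclid_ball_connected e : connected (@euclid_ball R e).
Proof.
have -> : @euclid_ball R e = \bigcup_(x in @euclid_ball R e)
    ((fun t : R => t *: x) @` `[0, 1]%classic).
  rewrite eqEsubset; split => [x bx|_ [x bx [t /= + <-]]].
    by exists x => //; exists 1; rewrite ?scale1r //= in_itv /= ler01 lexx.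
  rewrite in_itv /= => /andP[t0 t1]; apply: le_lt_trans bx.
  apply: ler_sum => i _; rewrite mxE exprMn ler_piMl ?sqr_ge0 //.
  by rewrite expr_le1.
apply: bigcup_connected => [|x bx].
  by exists 0 => x bx; exists 0; rewrite ?scale0r //= in_itv /= lexx ler01.
apply: connected_continuous_connected; first exact: segment_connected.
by apply: continuous_subspaceT; exact: scalel_continuous.
Qed.

Lemma euclid_ball0 e : @euclid_ball R e 0.
Proof. by rewrite /euclid_ball /= big1 ?ltr01 // => i _; rewrite mxE expr0n. Qed.

(** The part of [is_chart] that makes smooth maps into [T] continuous: injectivity, and images of
    open sets that are traces on one fixed set [B]. It passes to the charts of a disjoint union. *)
Definition chart_embedding (T : topologicalType) (c : chart R T) :=
  [/\ open (cdom c),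
      (forall x y, cdom c x -> cdom c y -> cmap c x = cmap c y -> x = y) &
      exists B, forall W, open W -> W `<=` cdom c ->
        exists2 Q, open Q & cmap c @` W = Q `&` B].

Lemma is_chart_embedding (T : topologicalType) (c : chart R T) :
  is_chart c -> chart_embedding c.
Proof. by move=> [oc _ ic [B _ hB]]; split => //; exists B. Qed.

Section BallsIn.
Variables (T : topologicalType) (AT : set (chart R T)).
Hypothesis AT_emb : forall c, AT c -> chart_embedding c.

(** In a chart at the target, [g] is the restriction of the continuous map [G]. A point whose
    coordinates fall in the trace [Q1] of a neighbourhood then belongs to that neighbourhood, the
    chart being injective. *)
Lemma smooth_on_continuous e (A : set 'rV[R]_e) (g : 'rV[R]_e -> T) :
  smooth_on (@euclid_atlas R e) AT A g -> {within A, continuous g}.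
Proof.
move=> gs; apply/subspace_continuousP => x Ax N Ngx.
have [c [c' [ec ATc' [cx c'gx [Q [G [oQ Qx GC hG]]]]]]] := gs x Ax.
rewrite ec /= in cx Q G oQ Qx GC hG *.
have [oc' ic' [B hB]] := AT_emb ATc'.
have [oW Wgx] : open (N° `&` cdom c') /\ (N° `&` cdom c') (g x).
  by split; [exact: openI (open_interior _) oc'|split].
have [Q1 oQ1 EQ1] := hB _ oW (@subIsetr _ _ _).
have [Q2 oQ2 EQ2] := hB _ oc' (@subset_refl _ _).
have [_ Ggx] := hG x Ax cx Qx.
have Q1gx : Q1 (G x).
  by have : (cmap c' @` (N° `&` cdom c')) (cmap c' (g x)) by [exists (g x)]; rewrite EQ1 -Ggx => -[].
have nQ1 : nbhs x (G @^-1` Q1).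
  by apply: (GC 0%N x Qx); apply: open_nbhs_nbhs.
have nQ : nbhs x Q by apply: open_nbhs_nbhs.
rewrite nbhs_simpl /=; near=> y.
have Ay : A y by near: y; exact: withinT.
have Qy : Q y by near: y; apply: cvg_within.
have Q1y : Q1 (G y) by near: y; apply: cvg_within.
have [c'y Ggy] := hG y Ay I Qy.
have : (cmap c' @` cdom c') (cmap c' (g y)) by exists (g y).
rewrite EQ2 => -[_ By].
have : (Q1 `&` B) (cmap c' (g y)) by split=> //; rewrite Ggy.
rewrite -EQ1 => -[w [Nw cw] /(ic' _ _ cw c'y) we].
by rewrite we in Nw; exact: interior_subset Nw.
Unshelve. all: by end_near. Qed.

Lemma diffeo_ball_connected e (B : set T) f :
  diffeo AT (@euclid_atlas R e) B (@euclid_ball R e) f -> connected B.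
Proof.
move=> [_ fB [g gs gK]].
have -> : B = g @` @euclid_ball R e.
  rewrite -fB; rewrite eqEsubset; split => [x Bx|_ [_ [x Bx <-] <-]]; last by rewrite gK.
  by exists (f x); [exists x|exact: gK].
apply: connected_continuous_connected (@euclid_ball_connected e) _.
exact: smooth_on_continuous gs.
Qed.

Lemma diffeo_ball_nonempty e (B : set T) f :
  diffeo AT (@euclid_atlas R e) B (@euclid_ball R e) f -> B !=set0.
Proof.
move=> [_ fB _]; have : (f @` B) 0 by rewrite fB; exact: euclid_ball0.
by move=> [x Bx _]; exists x.
Qed.

Definition open_ball (B : set T) := open B /\ exists (e : nat) (f : T -> 'rV[R]_e),
  diffeo AT (@euclid_atlas R e) B (@euclid_ball R e) f.

Lemma open_ball_connected B : open_ball B -> connected B.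
Proof. by move=> [_ [e [f /diffeo_ball_connected]]]. Qed.

Lemma open_ball_nonempty B : open_ball B -> B !=set0.
Proof. by move=> [_ [e [f /diffeo_ball_nonempty]]]. Qed.

(** [A] meets [B i] in a subset that is open and closed in [A], the union of the other pieces being
    open. The index type is arbitrary, to serve for the balls of an open set and for the summands of
    a disjoint union. *)
Lemma connected_sub_piece (I : Type) (B : I -> set T) (A : set T) i x :
  (forall l, open (B l)) -> (forall l l' y, B l y -> B l' y -> l = l') ->
  connected A -> A `<=` \bigcup_l B l -> A x -> B i x -> A `<=` B i.
Proof.
move=> oB tB cA AB Ax Bx.
suff -> : A = A `&` B i by exact: subIsetr.
apply/esym/cA; first by exists x.
- by exists (B i).
- exists (~` \bigcup_(l in [set l | l <> i]) B l).
    by apply: open_closedC; apply: bigcup_open.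
  rewrite eqEsubset; split => y [Ay].
    by move=> Biy; split => // -[l li Bly]; apply: li; exact: tB Bly Biy.
  move=> nB; split => //; have [l _ Bly] := AB y Ay.
  have [<-//|li] := pselect (l = i).
  by case: nB; exists l.
Qed.

Lemma at_most_balls_fin (I : finType) (X : {set I}) (B : I -> set T) k :
  (#|X| <= k)%N -> (forall i, i \in X -> open_ball (B i)) ->
  (forall i j y, B i y -> B j y -> i = j) ->
  at_most_balls AT k (\bigcup_(i in [set i | i \in X]) B i).
Proof.
move=> Xk bB tB; exists #|X| => //; exists (fun r => B (enum_val r)); split.
- rewrite eqEsubset; split => [x [i /= iX Bx]|x [r _ Bx]].
    by exists (enum_rank_in iX i) => //; rewrite enum_rankK_in.
  by exists (enum_val r) => //=; exact: enum_valP.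
- apply/trivIsetP => r s _ _ rs; rewrite -subset0 => y [Br Bs].
  by have /enum_val_inj e := tB _ _ _ Br Bs; rewrite e eqxx in rs.
- by move=> r; apply: bB; exact: enum_valP.
Qed.

Lemma at_most_balls_open k (V : set T) : at_most_balls AT k V -> open V.
Proof. by move=> [n _ [B [-> _ bB]]]; apply: bigcup_open => i _; case: (bB i). Qed.

(** The union of the connected components of [W] that meet [V], phrased without components or balls
    so that monotonicity and idempotence are formal. *)
Definition core_set (V W : set T) : set T :=
  [set x | exists A, [/\ connected A, A `<=` W, A x & A `&` V !=set0]].

Lemma core_set_ge V W : V `<=` W -> V `<=` core_set V W.
Proof.
move=> VW x Vx; exists [set x]; split => //; first exact: connected1.
  by move=> _ ->; exact: VW.
by exists x.
Qed.

Lemma core_set_le V W : core_set V W `<=` W.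
Proof. by move=> x [A [_ AW Ax _]]; exact: AW. Qed.

Lemma core_set_mono V W W' : W `<=` W' -> core_set V W `<=` core_set V W'.
Proof. by move=> WW' x [A [cA AW Ax AV]]; exists A; split => // y /AW /WW'. Qed.

Lemma core_set_id V W : core_set V (core_set V W) = core_set V W.
Proof.
rewrite eqEsubset; split => [|x [A [cA AW Ax AV]]]; first exact: core_set_le.
by exists A; split => // y Ay; exists A.
Qed.

(** The disjoint open balls of [W] are connected, so a connected subset lies in one of them and the
    core is a union of balls of [W]. The map [r], sending a ball of [V] to the ball of [W] around
    it, is onto the balls that meet [V]; this bounds their number by both counts. *)
Lemma core_set_balls V W t k : V `<=` W ->
  at_most_balls AT t V -> at_most_balls AT k W ->
  at_most_balls AT t (core_set V W) /\ at_most_balls AT k (core_set V W).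
Proof.
move=> VW [p pt [A [VA tA bA]]] [n nk [B [WB tB bB]]].
have {}tB i j y : B i y -> B j y -> i = j.
  move=> Bi Bj; apply: contrapT => ij.
  have /trivIsetP/(_ i j I I) := tB.
  by move=> /(_ (introN eqP ij)) h; have : (B i `&` B j) y by []; rewrite h.
have oB i : open (B i) by case: (bB i).
have cB i : connected (B i) by exact: open_ball_connected (bB i).
pose X := [set i | `[< B i `&` V !=set0 >]]%SET.
have EX : core_set V W = \bigcup_(i in [set i | i \in X]) B i.
  rewrite eqEsubset; split => [x [A' [cA' A'W A'x [y [A'y Vy]]]]|x [i iX Bix]].
    have := A'W x A'x; rewrite WB => -[i _ Bix].
    rewrite WB in A'W; have A'B := connected_sub_piece oB tB cA' A'W A'x Bix.
    by exists i => //=; rewrite inE; apply/asboolP; exists y; split => //; exact: A'B.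
  exists (B i); split => //; first by rewrite WB => y By; exists i.
  by move: iX; rewrite /= inE => /asboolP.
have Xn : (#|X| <= n)%N by rewrite -[X in (_ <= X)%N]card_ord max_card.
have /choice[r hr] (l : 'I_p) : exists i, A l `<=` B i.
  have [x Alx] := open_ball_nonempty (bA l).
  have AW : A l `<=` \bigcup_i B i.
    by rewrite -WB; apply: subset_trans VW; rewrite VA => y Ay; exists l.
  have [i _ Bix] := AW x Alx; exists i.
  exact: connected_sub_piece oB tB (open_ball_connected (bA l)) AW Alx Bix.
have Xp : (#|X| <= p)%N.
  rewrite -[X in (_ <= X)%N]card_ord; apply: leq_trans (leq_imset_card r _).
  apply/subset_leq_card/fintype.subsetP => i; rewrite inE => /asboolP[y [Biy]].
  rewrite VA => -[l _ Aly]; apply/imsetP; exists l => //.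
  by apply: tB Biy _; exact: hr Aly.
rewrite EX; split; apply: (at_most_balls_fin _ (fun i _ => bB i) tB).
- exact: leq_trans Xp pt.
- exact: leq_trans Xn nk.
Qed.

End BallsIn.
End Balls.

(** * Balls in a disjoint union *)

Section CoproductBalls.
Variables (R : realType) (m : nat) (P : 'I_m -> manifold R).

Lemma atlas_embedding i (c : chart R (P i)) : atlas c -> chart_embedding c.
Proof.
have [_ _ _ h _] := manifoldP (P i).
by move=> /h[/is_chart_embedding].
Qed.

Lemma coprod_atlas_embedding (c : chart R (coprod P)) :
  coprod_atlas c -> chart_embedding c.
Proof.
move=> [i [c0 /atlas_embedding[oc ic [B hB]] ->]]; split => /=.
- exact: existT_open_map.
- move=> _ _ [x cx <-] [y cy <-]; rewrite !untag_existT => /(ic _ _ cx cy) -> //.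
- exists B => W oW Wc; pose W0 := existT _ i @^-1` W.
  have [|x /Wc[y cy e]|Q oQ EQ] := hB W0.
  + exact: (sigT_openP _).1 oW i.
  + by rewrite -(eq_from_Tagged e).
  exists Q => //; rewrite -EQ eqEsubset; split => [_ [z Wz <-]|_ [x Wx <-]].
    have [x cx e] := Wc z Wz; subst z.
    by rewrite untag_existT; exists x.
  by exists (existT _ i x) => //; rewrite untag_existT.
Qed.

(** The summands are open, disjoint and cover the union. *)
Lemma connected_tag (A : set (coprod P)) z w : connected A -> A z -> A w -> tag w = tag z.
Proof.
move=> cA Az Aw.
pose B i : set (coprod P) := [set z | tag z = i].
have oB i : open (B i).
  have -> : B i = existT _ i @` setT.
    rewrite eqEsubset; split => [[j x] /= <-|_ [x _ <-]//]; by exists x.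
  by apply: existT_open_map; exact: openT.
have tB i j (x : coprod P) : B i x -> B j x -> i = j by move=> <- <-.
have AB : A `<=` \bigcup_l B l by move=> x Ax; exists (tag x).
exact: (connected_sub_piece oB tB cA AB Az (erefl : B (tag z) z) Aw).
Qed.

(** Being connected, [B] lies entirely in the summand of [y0], and both directions of its
    diffeomorphism can be read in the charts of that summand. *)
Lemma coprod_open_ball i (B : set (coprod P)) y0 : B (existT _ i y0) ->
  open_ball (coprod_atlas (P := P)) B ->
  open_ball (atlas (m := P i)) (existT _ i @^-1` B).
Proof.
move=> By0 bB; have cB := open_ball_connected coprod_atlas_embedding bB.
have Bi w : B w -> exists x, w = existT _ i x.
  move=> Bw; have := connected_tag cB By0 Bw; case: w {Bw} => j x /= e.
  by subst j; exists x.
case: bB => oB [e [f [fs fB [g gs gK]]]].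
split; first exact: (sigT_openP _).1 oB i.
exists e, (fun x => f (existT _ i x)); split.
- move=> x Bx; have [c [c' [[i0 [c0 hc0 ec]] hc1 sn]]] := fs _ Bx; subst c.
  case: sn => -[x0 cx0 ex] cf [Q [G [oQ Qx GC hG]]].
  have ii : i0 = i by case: ex.
  subst i0; have xx := eq_from_Tagged ex; subst x0.
  exists c0, c'; split => //; split => //.
  exists Q, G; split => //; first by move: Qx; rewrite /= untag_existT.
  move=> y By cy Qy; have := hG (existT _ i y) By.
  by rewrite /= untag_existT; apply => //; exists y.
- rewrite -fB eqEsubset; split => [_ [x Bx <-]|_ [w Bw <-]]; first by exists (existT _ i x).
  by have [x e'] := Bi w Bw; subst w; exists x.
(* [y0] is the default outside the summand; on the unit ball [g] takes its values in [B], inside the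
   summand. *)
- pose g' x : P i := untag y0 id (g x).
  have gB x : euclid_ball x -> B (g x) by rewrite -fB => -[w Bw <-]; rewrite gK.
  exists g' => [x bx|x Bx]; last by rewrite /g' gK // untag_existT.
  have [c [c' [hc [i0 [c0 hc0 ec]] sn]]] := gs _ bx; subst c'.
  case: sn => cx -[x0 cx0 ex] [Q [G [oQ Qx GC hG]]].
  have [x1 ex1] := Bi _ (gB x bx).
  have ii : i0 = i by have := etrans ex ex1; case.
  subst i0.
  exists c, c0; split => //; split => //; first by rewrite /g' -ex untag_existT.
  exists Q, G; split => // y by_ cy Qy; have [[w cw ew] Gy] := hG y by_ cy Qy.
  by move: Gy; rewrite /g' -ew /= !untag_existT.
Qed.

(** Each ball lies in a single summand, found from one of its points; the balls counted by summand
    form the tuple, whose total is the number of balls. *)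
Lemma Ok_Oj k (U V : opens (coprod P)) : Ok (coprod_atlas (P := P)) k U V ->
  exists2 t : m.-tupleprod nat, total_le k t & Oj t U V.
Proof.
move=> [VU [n nk [B [VB tB bB]]]].
have {}tB i j y : B i y -> B j y -> i = j.
  move=> Bi Bj; apply: contrapT => ij.
  have /trivIsetP/(_ i j I I) := tB.
  by move=> /(_ (introN eqP ij)) h; have : (B i `&` B j) y by []; rewrite h.
have /choice[z hz] l := open_ball_nonempty (bB l).
have cB l := open_ball_connected coprod_atlas_embedding (bB l).
pose X i := [set l | tag (z l) == i]%SET.
exists [tuple #|X i| | i < m].
  rewrite /total_le /=; apply: leq_trans nk.
  under eq_bigr do rewrite tnth_mktuple -sum1_card.
  rewrite -[X in (_ <= X)%N](card_ord n) -sum1_card (partition_big (fun l => tag (z l)) xpredT) //=.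
  by apply: leq_sum => i _; rewrite (eq_bigl (fun l => tag (z l) == i)) // => l; rewrite inE.
move=> i; split; first exact: part_mono.
rewrite tnth_mktuple.
have -> : val (part V i) = \bigcup_(l in [set l | l \in X i]) (existT _ i @^-1` B l).
  rewrite /= VB eqEsubset; split => [x [l _ Bx]|x [l _ Bx]]; last by exists l.
  exists l => //=; rewrite inE; apply/eqP.
  by have := connected_tag (cB l) (hz l) Bx => /= ->.
apply: at_most_balls_fin => // [l|l l' y]; last exact: tB.
rewrite inE => /eqP e; move: (hz l) e; case: (z l) => j x /= Bx e; subst j.
exact: coprod_open_ball Bx (bB l).
Qed.

End CoproductBalls.

(** * Cores and ball counts for open sets of a disjoint union *)

Section CoproductCore.
Variables (R : realType) (m : nat) (P : 'I_m -> manifold R) (k : nat).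
Variable U : opens (coprod P).
Let S := Ok (coprod_atlas (P := P)) k U.
Implicit Types V W : opens (coprod P).

Definition coprod_core_set V W : set (coprod P) :=
  [set z | core_set (val (part V (tag z))) (val (part W (tag z))) (tagged z)].

(** Taking the interior makes this an open set for all [V] and [W]. For [V <= W] in [S] the set is
    already open, as a union of balls, and the interior changes nothing. *)
Definition coprod_core V W : opens (coprod P) :=
  mkopens (open_interior (coprod_core_set V W)).

(** Some tuple of total at most [k] that bounds the numbers of balls of [V] in the summands; the
    contraction works with any such bound, exact or not. *)
Definition ball_count V : m.-tupleprod nat :=
  xget [tuple 0%N | i < m] [set t | total_le k t /\ Oj t U V].

Lemma ball_countP V : S V -> total_le k (ball_count V) /\ Oj (ball_count V) U V.
Proof.
move=> /Ok_Oj[t tk tV].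
by have := @xgetPex _ [tuple 0%N | i < m] _ (ex_intro [set t | total_le k t /\ Oj t U V] t (conj tk tV)).
Qed.

Lemma core_part_balls V W (t j : m.-tupleprod nat) i : (V <= W)%O ->
  Oj t U V -> Oj j U W ->
  let A := core_set (val (part V i)) (val (part W i)) in
  at_most_balls (atlas (m := P i)) (tnth t i) A /\
  at_most_balls (atlas (m := P i)) (tnth j i) A.
Proof.
move=> VW /(_ i)[_ hV] /(_ i)[_ hW]; apply: core_set_balls => //.
  exact: atlas_embedding.
exact/leopP/part_mono.
Qed.

Lemma coprod_coreE V W : S V -> S W -> (V <= W)%O ->
  val (coprod_core V W) = coprod_core_set V W.
Proof.
move=> /ball_countP[_ hV] /ball_countP[_ hW] VW; apply/esym; rewrite -[RHS]/(_°).
apply/esym/interior_id/(sigT_openP _).2 => i.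
have [h _] := core_part_balls i VW hV hW.
exact: at_most_balls_open h.
Qed.

Lemma coprod_core_ge V W : S V -> S W -> (V <= W)%O -> (V <= coprod_core V W)%O.
Proof.
move=> SV SW VW; apply/leopP; rewrite coprod_coreE // => -[i x] Vx.
by apply: core_set_ge => //; exact/leopP/part_mono.
Qed.

Lemma coprod_core_le V W : S V -> S W -> (V <= W)%O -> (coprod_core V W <= W)%O.
Proof.
by move=> SV SW VW; apply/leopP; rewrite coprod_coreE // => -[i x] /core_set_le.
Qed.

Lemma part_core V W i : S V -> S W -> (V <= W)%O ->
  val (part (coprod_core V W) i) = core_set (val (part V i)) (val (part W i)).
Proof.
move=> SV SW VW; rewrite -[LHS]/(existT _ i @^-1` val (coprod_core V W)).
by rewrite coprod_coreE.
Qed.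

Lemma coprod_core_Oj_both V W (t j : m.-tupleprod nat) : S V -> S W -> (V <= W)%O ->
  Oj t U V -> Oj j U W -> Oj t U (coprod_core V W) /\ Oj j U (coprod_core V W).
Proof.
move=> SV SW VW tV jW.
have WU : (coprod_core V W <= U)%O.
  by apply: le_trans (coprod_core_le SV SW VW) _; case: SW.
split=> i; split; rewrite ?part_core //; try exact: part_mono.
  by have [] := core_part_balls i VW tV jW.
by have [] := core_part_balls i VW tV jW.
Qed.

Lemma coprod_core_mono V W W' : S V -> S W -> S W' -> (V <= W)%O -> (W <= W')%O ->
  (coprod_core V W <= coprod_core V W')%O.
Proof.
move=> SV SW SW' VW WW'; apply/leopP.
rewrite !coprod_coreE //; last exact: le_trans WW'.
by move=> [i x]; apply: core_set_mono; exact/leopP/part_mono.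
Qed.

Lemma coprod_core_id V W : S V -> S W -> (V <= W)%O ->
  coprod_core V (coprod_core V W) = coprod_core V W.
Proof.
move=> SV SW VW.
have [tk hV] := ball_countP SV; have [_ hW] := ball_countP SW.
have [hc _] := coprod_core_Oj_both SV SW VW hV hW.
(* The core obeys the same bounds on the numbers of balls as [V], whose total is at most [k]. *)
have Sc : S (coprod_core V W) := Oj_sub_Ok tk hc.
apply: val_inj; rewrite coprod_coreE ?coprod_core_ge // coprod_coreE //.
have e i : core_set (val (part V i)) (val (part (coprod_core V W) i)) =
    core_set (val (part V i)) (val (part W i)) by rewrite part_core // core_set_id.
apply/seteqP; split => -[i x] h.
  have : core_set (val (part V i)) (val (part (coprod_core V W) i)) x := h.
  by rewrite e.
suff : core_set (val (part V i)) (val (part (coprod_core V W) i)) x by [].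
by rewrite e.
Qed.

Definition tuple_meet (j j' : m.-tupleprod nat) : m.-tupleprod nat :=
  [tuple minn (tnth j i) (tnth j' i) | i < m].

Lemma tuple_meet_l j j' : (tuple_meet j j' <= j)%O.
Proof. by rewrite leEtprod; apply/forallP => i; rewrite tnth_mktuple leEnat geq_minl. Qed.

Lemma tuple_meet_r j j' : (tuple_meet j j' <= j')%O.
Proof. by rewrite leEtprod; apply/forallP => i; rewrite tnth_mktuple leEnat geq_minr. Qed.

Lemma tuple_meet_glb (i j j' : m.-tupleprod nat) :
  (i <= j)%O -> (i <= j')%O -> (i <= tuple_meet j j')%O.
Proof.
rewrite !leEtprod => /forallP h /forallP h'; apply/forallP => l.
by rewrite tnth_mktuple leEnat leq_min -!leEnat h h'.
Qed.

Lemma tuple_meet_total j j' : total_le k j -> total_le k (tuple_meet j j').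
Proof.
rewrite /total_le /=; apply: leq_trans; apply: leq_sum => i _.
by rewrite tnth_mktuple geq_minl.
Qed.

(** In each summand the minimum is one of the two bounds. *)
Lemma tuple_meet_Oj j j' V : Oj j U V -> Oj j' U V -> Oj (tuple_meet j j') U V.
Proof.
move=> h h' i; rewrite tnth_mktuple.
by have [_|_] := leqP (tnth j i) (tnth j' i).
Qed.

End CoproductCore.

Theorem theorem6p1 (R : realType) (m : nat) (P : 'I_m -> manifold R)
    (P_compact : forall i : 'I_m, compact [set: P i]%classic)
    (F : presheaf (opens (coprod P)))
    (F_spaces : space_valued F)
    (F_good : good F (coprod_atlas (P := P)))
    (b : simp (fob F (opens_top (coprod P))) 0)
    (k : nat) :
  objectwise_equiv (Tk_to_holim_Tj F k).
Proof.
move=> U.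
(* Here [U] also serves as the default open set [c0]. *)
apply: (@holim_cover_weak_equiv _ _ _ _ F _ _ _ F_spaces
  (fun j j' jj' => @Oj_mono R m P j j' U U jj' (lexx U))
  (fun j jk => @Oj_sub_Ok R m P k j U jk) U
  (ball_count k U) (@coprod_core R m P) (@tuple_meet m)).
- by move=> V /ball_countP[].
- by move=> V /ball_countP[].
- by move=> V W; exact: coprod_core_ge.
- by move=> V W; exact: coprod_core_le.
- by move=> V W; exact: coprod_core_id.
- move=> V W SV SW VW; have [_ hV] := ball_countP SV; have [_ hW] := ball_countP SW.
  by have [] := coprod_core_Oj_both SV SW VW hV hW.
- move=> V W j SV SW VW jk hW; have [_ hV] := ball_countP SV.
  by have [] := coprod_core_Oj_both SV SW VW hV hW.
- by move=> V W W'; exact: coprod_core_mono.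
- exact: tuple_meet_l.
- exact: tuple_meet_r.
- exact: tuple_meet_glb.
- exact: tuple_meet_total.
- by move=> j j' V; exact: tuple_meet_Oj.
Qed.
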